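(* Let $(M,g,J)$ be any almost-Hermitian manifold and let $f,h,b,c:T_M\to\mathbb{R}$ be smooth functions on the total space $T_M$ of its tangent bundle, with $a=b+ic$ and $fh-|a|^2\neq 0$ everywhere. Then the ciconia metric $\mathrm{g}_{f,a,h}$ on $T_M$ is itself almost-Hermitian: it is compatible with the almost-complex structure $\mathbb{J}=\pi^*J\oplus\pi^{\star}J$ of $T_M$, i.e. $\mathrm{g}_{f,a,h}(\mathbb{J}X,\mathbb{J}Y)=\mathrm{g}_{f,a,h}(X,Y)$ for all $X,Y\in T(T_M)$ over the same point.
   Context: Let $m=\dim M$ (even), $\pi:T_M\to M$ the projection, and $\nabla$ the Levi-Civita connection of $g$. The tangent bundle of the manifold $T_M$ splits as $T(T_M)=H^\nabla\oplus V$, where $V=\ker d\pi$ is canonically identified with the pullback of $TM$ (vertical lift), and $H^\nabla$ is the horizontal distribution of $\nabla$, identified with the pullback of $TM$ via $d\pi$ (horizontal lift). For $x\in T_{\pi(u)}M$, write $x^h\in H^\nabla_u$ and $x^v\in V_u$ for its horizontal and vertical lifts at $u\in T_M$. The almost-complex structure $\mathbb{J}=\pi^*J\oplus\pi^{\star}J$ is given by $\mathbb{J}x^h=(Jx)^h$ and $\mathbb{J}x^v=(Jx)^v$. The ciconia metric $\mathrm{g}_{f,a,h}$, with $a=b+ic$, is the symmetric bilinear form on $T_M$ defined at $u\in T_M$, for $x,y\in T_{\pi(u)}M$, by $$\mathrm{g}_{f,a,h}(x^h,y^h)=f(u)\,g(x,y),\quad \mathrm{g}_{f,a,h}(x^v,y^v)=h(u)\,g(x,y),\quad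 \mathrm{g}_{f,a,h}(x^h,y^v)=g\big(b(u)x+c(u)Jx,\,y\big).$$ It may be indefinite; ''almost-Hermitian'' refers to compatibility (in the possibly pseudo-Riemannian sense) with the almost-complex structure. *)

(* Defs.v *)
From HB Require Import structures.
From mathcomp Require Import all_boot all_order all_algebra.
From mathcomp Require Import all_classical all_reals all_analysis.

Set Implicit Arguments.
Unset Strict Implicit.
Unset Printing Implicit Defensive.

Import Order.TTheory GRing.Theory Num.Theory.
Import numFieldNormedType.Exports.

Local Open Scope classical_set_scope.
Local Open Scope ring_scope.

Section SmoothMaps.
Context {R : realType} {n : nat} {V : normedModType R}.
Implicit Types (U : set 'rV[R]_n) (F : 'rV[R]_n -> V).

Fixpoint Ck_on (k : nat) U F : Prop :=
  if k is k'.+1 then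
    (forall x, U x -> differentiable F x) /\
    (forall v : 'rV[R]_n, Ck_on k' U (fun x => 'D_v F x))
  else forall x, U x -> {for x, continuous F}.

Definition smooth_on U F : Prop := forall k, Ck_on k U F.

Definition smooth_near (x : 'rV[R]_n) F : Prop :=
  exists U, [/\ open U, U x & smooth_on U F].

End SmoothMaps.

(* The raw data of a set with n-dimensional charts; [chart i] is only
   meaningful on [dom i].  The topology is the one induced by the charts. *)
Record atlas (R : realType) (n : nat) := Atlas {
  carrier :> Type;
  index : Type;
  dom : index -> set carrier;
  chart : index -> carrier -> 'rV[R]_n }.

Section Manifolds.
Context {R : realType} {n : nat}.
Implicit Type M : atlas R n.

(* The local representative [F \o (chart i)^-1], extended by 0 outside
   [chart i @` dom i]. *)
Definition local_rep M {V : normedModType R} (i : index M) (F : M -> V) :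
    'rV[R]_n -> V :=
  fun x => xget 0 [set F p | p in dom i `&` chart i @^-1` [set x]].

Definition mopen M (W : set M) : Prop :=
  forall i : index M, open (chart i @` (W `&` dom i)).

Record smooth_manifold M : Prop := SmoothManifold {
  atlas_cover : forall p : M, exists i : index M, dom i p;
  atlas_inj : forall i : index M, {in dom i &, injective (chart i)};
  atlas_open : forall i j : index M, open (chart i @` (dom i `&` dom j));
  atlas_smooth : forall i j : index M,
    smooth_on (chart i @` (dom i `&` dom j)) (local_rep i (chart j));
  atlas_hausdorff : forall p q : M, p <> q -> exists W W' : set M,
    [/\ mopen W, mopen W', W p, W' q & W `&` W' = set0];
  atlas_second_countable : exists D : set (index M),
    countable D /\ \bigcup_(i in D) dom i = setT }.

(* A tangent vector at p is given by its components in all the charts around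
   p, related by the differentials of the transition maps; the components in
   the charts which do not contain p are set to 0. *)
Definition tangent_pred M (p : M) : {pred index M -> 'rV[R]_n} := fun v =>
  `[< (forall i, ~ dom i p -> v i = 0) /\
      (forall i j, dom i p -> dom j p ->
         v j = 'd (local_rep i (chart j)) (chart i p) (v i)) >].

Lemma tangent_submod_closed M (p : M) : submod_closed (tangent_pred p).
Proof.
split=> [|a v w /asboolP[v0 vd] /asboolP[w0 wd]]; apply/asboolP; split=> //.
- by move=> i j _ _; rewrite [RHS]linear0.
- move=> i ip; transitivity (a *: v i + w i) => //.
  by rewrite (v0 i ip) (w0 i ip) [_ *: _]scaler0 [LHS]addr0.
- move=> i j ip jp; transitivity (a *: v j + w j) => //.
  by rewrite (vd i j ip jp) (wd i j ip jp); exact/esym/linearP.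
Qed.

HB.instance Definition _ M (p : M) :=
  GRing.isSubmodClosed.Build R (index M -> 'rV[R]_n) (tangent_pred p)
    (tangent_submod_closed p).

Record tangent M (p : M) := Tangent {
  components :> index M -> 'rV[R]_n;
  _ : components \in tangent_pred p }.

HB.instance Definition _ M (p : M) := [isSub for @components M p].
HB.instance Definition _ M (p : M) := [Choice of tangent p by <:].
HB.instance Definition _ M (p : M) :=
  [SubChoice_isSubLmodule of tangent p by <:].

Definition vfield M := forall p : M, tangent p.

Definition smooth_fun_at M {V : normedModType R} (F : M -> V) (p : M) : Prop :=
  forall i : index M, dom i p -> smooth_near (chart i p) (local_rep i F).

Definition smooth_vfield_at M (X : vfield M) (p : M) : Prop :=
  forall i : index M, dom i p ->
    smooth_near (chart i p) (local_rep i (fun q => X q i)).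

(* The derivative dF_p(x) of a function F smooth near p. *)
Definition dfun M (F : M -> R) (p : M) (x : tangent p) : R :=
  xget 0 [set y | exists i : index M,
    dom i p /\ y = 'd (local_rep i F) (chart i p) (x i)].

Definition lie_bracket M (X Y : vfield M) (p : M) : tangent p :=
  xget 0 [set v : tangent p | forall i : index M, dom i p ->
    v i = 'd (local_rep i (fun q => Y q i)) (chart i p) (X p i)
        - 'd (local_rep i (fun q => X q i)) (chart i p) (Y p i)].

Definition bilinear_field M := forall p : M, tangent p -> tangent p -> R.
Definition endo_field M := forall p : M, tangent p -> tangent p.

Definition symmetric_bilinear M (p : M) (B : tangent p -> tangent p -> R) :=
  (forall a x y z, B (a *: x + y) z = a * B x z + B y z) /\
  (forall x y, B x y = B y x).

Record pseudo_riemannian M (g : bilinear_field M) : Prop := PseudoRiemannian {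
  metric_sym : forall p, symmetric_bilinear (g p);
  metric_nondeg : forall (p : M) x, (forall y, g p x y = 0) -> x = 0;
  metric_smooth : forall (p : M) (X Y : vfield M),
    smooth_vfield_at X p -> smooth_vfield_at Y p ->
    smooth_fun_at (fun q => g q (X q) (Y q)) p }.

Definition positive_definite M (g : bilinear_field M) : Prop :=
  forall (p : M) x, x != 0 -> 0 < g p x x.

Record almost_complex M (J : endo_field M) : Prop := AlmostComplex {
  acs_linear : forall p, linear (J p);
  acs_sqr : forall (p : M) x, J p (J p x) = - x;
  acs_smooth : forall (p : M) (X : vfield M),
    smooth_vfield_at X p -> smooth_vfield_at (fun q => J q (X q)) p }.

(* The metric may be indefinite. *)
Record almost_hermitian M (g : bilinear_field M) (J : endo_field M) : Prop :=
  AlmostHermitian {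
    ah_metric : pseudo_riemannian g;
    ah_complex : almost_complex J;
    ah_compatible : forall (p : M) x y, g p (J p x) (J p y) = g p x y }.

(* [D p x s] is the covariant derivative of the vector field s in the
   direction x at p.  Only fields smooth near p are constrained; since the
   Leibniz rule is required for all functions smooth near p, [D p x s] only
   depends on the germ of s at p. *)
Definition covariant_derivative M :=
  forall p : M, tangent p -> vfield M -> tangent p.

Record is_connection M (D : covariant_derivative M) : Prop := IsConnection {
  conn_linear : forall (p : M) (s : vfield M), smooth_vfield_at s p ->
    linear (fun x => D p x s);
  conn_add : forall (p : M) x (s t : vfield M),
    smooth_vfield_at s p -> smooth_vfield_at t p ->
    D p x (fun q => s q + t q) = D p x s + D p x t;
  conn_leibniz : forall (p : M) x (F : M -> R) (s : vfield M),
    smooth_fun_at F p -> smooth_vfield_at s p ->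
    D p x (fun q => F q *: s q) = dfun F x *: s p + F p *: D p x s;
  conn_smooth : forall (p : M) (X s : vfield M),
    smooth_vfield_at X p -> smooth_vfield_at s p ->
    smooth_vfield_at (fun q => D q (X q) s) p }.

Record levi_civita M (g : bilinear_field M) (D : covariant_derivative M) :
    Prop := LeviCivita {
  lc_connection : is_connection D;
  lc_torsion_free : forall (p : M) (X Y : vfield M),
    smooth_vfield_at X p -> smooth_vfield_at Y p ->
    D p (X p) Y - D p (Y p) X = lie_bracket X Y p;
  lc_metric : forall (p : M) x (Y Z : vfield M),
    smooth_vfield_at Y p -> smooth_vfield_at Z p ->
    dfun (fun q => g q (Y q) (Z q)) x =
    g p (D p x Y) (Z p) + g p (Y p) (D p x Z) }.

(* The total space T_M: the chart induced by [chart i] sends (p, v) to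
   (chart i p, v i); [tag] is the projection to M. *)
Definition tangent_bundle M : atlas R (n + n) :=
  @Atlas R (n + n) {p : M & tangent p} (index M)
    (fun i u => dom i (tag u))
    (fun i u => row_mx (chart i (tag u)) (tagged u i)).

End Manifolds.

Arguments tangent_bundle {R n} M.

Section Ciconia.
Context {R : realType} {n : nat} (M : atlas R n).
Local Notation TM := (tangent_bundle M).

Definition section_point (s : vfield M) (p : M) : TM := existT _ p (s p).

(* The horizontal lift of x at u is ds_p(x) for any vector field s through u
   which is D-parallel in the direction x at p = tag u. *)
Definition hlift (D : covariant_derivative M) (u : TM) (x : tangent (tag u)) :
    tangent u :=
  xget 0 [set X : tangent u | exists s : vfield M,
    [/\ smooth_vfield_at s (tag u), s (tag u) = tagged u, D _ x s = 0 &
      forall i : index M, dom i (tag u) ->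
        X i = 'd (local_rep i (fun q => @chart _ _ TM i (section_point s q)))
                 (chart i (tag u)) (x i)]].

(* The vertical lift of x at u is the velocity at t = 0 of t |-> u + t x. *)
Definition vlift (u : TM) (x : tangent (tag u)) : tangent u :=
  xget 0 [set X : tangent u | forall i : index M, dom i (tag u) ->
    X i = derive1 (fun t : R =>
      @chart _ _ TM i (existT _ (tag u) (tagged u + t *: x))) 0].

Definition is_lifted_acs (D : covariant_derivative M) (J : endo_field M)
    (u : TM) (K : tangent u -> tangent u) : Prop :=
  [/\ linear K,
      forall x, K (hlift D x) = hlift D (J _ x) &
      forall x, K (vlift x) = vlift (J _ x)].

Definition lifted_acs (D : covariant_derivative M) (J : endo_field M) :
    endo_field TM :=
  fun u => xget (fun=> 0) (@is_lifted_acs D J u).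

Definition is_ciconia (g : bilinear_field M) (J : endo_field M)
    (D : covariant_derivative M) (f b c h : TM -> R)
    (u : TM) (G : tangent u -> tangent u -> R) : Prop :=
  [/\ symmetric_bilinear G,
      forall x y, G (hlift D x) (hlift D y) = f u * g _ x y,
      forall x y, G (vlift x) (vlift y) = h u * g _ x y &
      forall x y, G (hlift D x) (vlift y) = g _ (b u *: x + c u *: J _ x) y].

Definition ciconia (g : bilinear_field M) (J : endo_field M)
    (D : covariant_derivative M) (f b c h : TM -> R) : bilinear_field TM :=
  fun u => xget (fun _ _ => 0) (@is_ciconia g J D f b c h u).

End Ciconia.

(* Main.v *)
From HB Require Import structures.
From mathcomp Require Import all_boot all_order all_algebra.
From mathcomp Require Import all_classical all_reals all_analysis.
From mathcomp Require Import ring.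
Require Import Defs.
Import Order.TTheory GRing.Theory Num.Theory.
Import numFieldNormedType.Exports.

(** The compatibility of the metric with the almost-complex structure is
pointwise linear algebra.  At a point [u] of the tangent bundle every vector is
uniquely [x^h + y^v], the structure acts as [J] on both components, and in each
block of the metric [J] passes through [g]: the diagonal blocks are multiples
of [g], and the mixed block is [g (b x + c J x) y], where [b + c J] commutes
with [J].
The metric is nondegenerate because the system of equations
[f x + (b - c J) y = 0], [(b + c J) x + h y = 0] satisfied by a vector
[x^h + y^v] of its kernel has determinant [f h - (b^2 + c^2)], the coefficients
being polynomials in [J], which commute.  This algebra is carried out for an
abstract splitting [W = H V + L V] ([split_form_compatible],
[split_form_nondeg], [split_acs_sqr]).

What remains is differential geometry: the lifts must exist and be linear, they
must split the tangent spaces of the tangent bundle, and everything must depend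
smoothly on [u].  All of it is read in charts.  A chart of [M] identifies the
tangent space at [p] with the space of row vectors ([tangent_ext],
[tangent_exists]), and the charts which it induces on the tangent bundle are
again smoothly compatible ([tangent_bundle_compatible]), so that the same holds
for the tangent spaces of the tangent bundle.  A connection is determined in a
chart by its Christoffel form [Gamma]: if [s] is a vector field, then
[D_x s = ds(x) + Gamma(x, s)] ([conn_chart]).  A field [s] through [u] which is
parallel along [x] therefore has derivative [- Gamma(x, u)] along [x], whence
  [x^h = (x, - Gamma(x, u))]  and  [y^v = (0, y)]
in the chart ([hlift_chart], [vlift_chart]); such a field exists since an affine
map with the prescribed value and derivative does ([parallel_section]).

These formulas show that the lifts split the tangent space, with projections
[(xi, eta) |-> xi] and [(xi, eta) |-> eta + Gamma(xi, u)] ([hv_splitting]).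
They also express the metric and the almost-complex structure as sums of
products of smooth functions: [f], [h], [b], [c], the fibre coordinates of [u],
and the coefficients of [g], [J] and [Gamma] in the coordinate frame
([ciconia_smooth], [lifted_acs_smooth]). *)

Set Implicit Arguments.
Unset Strict Implicit.
Unset Printing Implicit Defensive.
Local Open Scope classical_set_scope.
Local Open Scope ring_scope.

(** * Differentials of maps between normed spaces *)

Section DiffExtra.
Context {R : realType} {V W : normedModType R}.

(** ['d f x] is obtained by choice and is only characterised when [f] is
differentiable, so its locality has to go through the uniqueness of the
differential. *)
Lemma near_eq_diff (f g : V -> W) x : (\near x, f x = g x) ->
  differentiable f x -> differentiable g x /\ 'd g x = 'd f x :> (V -> W).
Proof.
move=> fg df.
have H : g \o shift x = cst (g x) + 'd f x +o_ 0 id.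
  apply/eqaddoP => _/posnumP[e].
  have /eqaddoP/(_ _ (gt0 e)) := diff_locally df.
  have : \forall h \near 0, f (h + x) = g (h + x).
    have := fg; rewrite (near_shift 0) /=.
    by apply: filterS => h /=; rewrite subr0.
  apply: filterS2 => h fgh; rewrite /= !fctE /=.
  by rewrite fgh (nbhs_singleton fg).
have E := diff_unique (diff_continuous df) H.
split=> //; apply/diff_locallyP; rewrite E.
by split=> //; exact: diff_continuous.
Qed.

(** The product rule for a function times a map follows from the
differential of the bilinear map [(a, v) |-> a *: v]. *)
Lemma diff_scale (a : V -> R) (f : V -> W) x :
  differentiable a x -> differentiable f x ->
  differentiable (fun y => a y *: f y) x /\
  'd (fun y => a y *: f y) x
    = (fun v => a x *: 'd f x v + 'd a x v *: f x) :> (V -> W).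
Proof.
move=> da df.
have blin : bilinear_for (GRing.Scale.Law.clone _ _ *:%R _)
    (GRing.Scale.Law.clone _ _ *:%R _) (@GRing.scale R W).
  by split=> [u'|u] c y z /=;
    rewrite ?scalerDl ?scalerDr !scalerA // [c * _]mulrC.
pose bM := bilinear_isBilinear.Build R R W W _ _ (@GRing.scale R W) blin.
pose b : {bilinear R -> W -> W} := HB.pack (@GRing.scale R W) bM.
have bc : continuous (fun p : R * W => b p.1 p.2) by exact: scale_continuous.
have dp := differentiable_pair da df.
have db := differentiable_bilin (a x, f x) bc.
split; first exact: (differentiable_comp dp db).
by rewrite (diff_comp dp db) diff_bilin // diff_pair.
Qed.

Lemma derive_scale (a : V -> R) (f : V -> W) x v :
  differentiable a x -> differentiable f x ->
  'D_v (fun y => a y *: f y) x = a x *: 'D_v f x + 'D_v a x *: f x.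
Proof.
by move=> da df; have [d E] := diff_scale da df; rewrite !deriveE // E.
Qed.

Lemma diff_affine_near (a : W) (L : {linear V -> W}) (f : V -> W) x v :
  continuous L -> (\near x, a + L x = f x) -> 'd f x v = L v.
Proof.
move=> cL aL.
have da : differentiable (cst a : V -> W) x by exact: differentiable_cst.
have dL : differentiable L x by exact: linear_differentiable.
have [_ ->] := @near_eq_diff (cst a + L) f x aL (differentiableD da dL).
rewrite (diffD da dL) diff_cst (diff_lin x cL); exact: add0r.
Qed.

Lemma diff_line (A B : W) (t : R) :
  differentiable (fun t : R => A + t *: B) t /\
  'd (fun t : R => A + t *: B) t 1 = B.
Proof.
have dl := is_diff_scalel t B; have dA := is_diff_cst A t.
have [d E] := is_diffD dA dl; split; first exact: d.
have -> : 'd (fun t : R => A + t *: B) t = (0 + *:%R^~ B) :> (R -> W).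
  exact: E.
by rewrite !fctE /= scale1r add0r.
Qed.

Lemma near_eq_continuous (f g : V -> W) x : (\near x, f x = g x) ->
  {for x, continuous f} -> {for x, continuous g}.
Proof.
move=> fg cf; have fgx : f x = g x := nbhs_singleton fg.
have : f @ x --> g x by rewrite -fgx; exact: cf.
by apply: cvg_trans; exact: near_eq_cvg.
Qed.

End DiffExtra.

Section DiffComp.
Context {R : realType} {U V W : normedModType R}.

Lemma derive_comp (f : U -> V) (g : V -> W) x v :
  differentiable f x -> differentiable g (f x) ->
  'D_v (g \o f) x = 'd g (f x) ('D_v f x).
Proof.
move=> df dg; have d := differentiable_comp df dg.
by rewrite (deriveE v d) (diff_comp df dg) /= deriveE.
Qed.

Lemma derive_postlin (f : U -> V) (L : {linear V -> W}) x v :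
  continuous L -> differentiable f x -> 'D_v (L \o f) x = L ('D_v f x).
Proof.
move=> cL df; have dL : differentiable L (f x) by exact: linear_differentiable.
by rewrite derive_comp // (diff_lin (f x) cL).
Qed.

(** The chain rule for a map known only near [x] to be a composite: a change of
charts is a composite only on the overlap of the two domains. *)
Lemma diff_comp_near (f : U -> V) (g : V -> W) (h : U -> W) x y v : f x = y ->
  differentiable f x -> differentiable g y -> (\near x, g (f x) = h x) ->
  'd g y ('d f x v) = 'd h x v.
Proof.
move=> <- df dg gfh.
have dgf := differentiable_comp df dg.
have [_ ->] := @near_eq_diff _ _ _ (g \o f) h x gfh dgf.
by rewrite (diff_comp df dg).
Qed.

End DiffComp.

(** * Maps of class C^k on open sets *)

Section LinCont.
Context {R : realType}.
(** A linear map out of a space of row vectors is a finite sum of coordinates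
times constant vectors. *)
Lemma linear_continuous_rV n (V : normedModType R)
    (L : {linear 'rV[R]_n -> V}) : continuous L.
Proof.
have -> : (L : _ -> _)
    = fun v : 'rV[R]_n => \sum_(j < n) v 0 j *: L (delta_mx 0 j).
  apply/funext => v; rewrite [in LHS](row_sum_delta v) linear_sum.
  by apply: eq_bigr => j _; rewrite linearZ.
elim: (index_enum _) => [|j r IH].
  by under eq_fun do rewrite big_nil; exact: cst_continuous.
under eq_fun do rewrite big_cons.
move=> v; apply: (@continuousD R V 'rV[R]_n (fun v => v 0 j *: _)).
  2: exact: IH.
apply: (@continuousZr_tmp R V 'rV[R]_n (fun v => v 0 j)).
exact: coord_continuous.
Qed.
End LinCont.

Section CkCalculus.
Context {R : realType} {n : nat}.
Implicit Types (V W : normedModType R) (U : set 'rV[R]_n).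

Lemma Ck_on_sub V k U U' (F : 'rV[R]_n -> V) :
  U' `<=` U -> Ck_on k U F -> Ck_on k U' F.
Proof.
move=> sU; elim: k F => [|k IH] F /=; first by move=> H x /sU /H.
by move=> [dF H]; split=> [x /sU /dF//|v]; exact/IH/H.
Qed.

Lemma Ck_on_lower V k U (F : 'rV[R]_n -> V) : Ck_on k.+1 U F -> Ck_on k U F.
Proof.
elim: k F => [|k IH] F [dF H] /=.
  by move=> x /dF /differentiable_continuous.
by split=> // v; exact/IH/H.
Qed.

Lemma Ck_on_eq V k U (F G : 'rV[R]_n -> V) : open U ->
  {in U, F =1 G} -> Ck_on k U F -> Ck_on k U G.
Proof.
move=> oU; elim: k F G => [|k IH] F G FG;
  have nFG x : U x -> \forall y \near x, F y = G y.
1,3: by move=> Ux; near=> y; apply: FG; rewrite inE; near: y;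
  exact: open_nbhs_nbhs.
  by move=> H x Ux; exact: near_eq_continuous (nFG x Ux) (H x Ux).
move=> [dF H]; split=> [x Ux|v].
  by have [] := near_eq_diff (nFG x Ux) (dF x Ux).
apply: IH (H v) => x; rewrite inE => Ux.
by apply: near_eq_derive; exact: nFG.
Unshelve. all: by end_near. Qed.

Lemma Ck_on_cst V k U (a : V) : Ck_on k U (fun=> a).
Proof.
elim: k a => [|k IH] a /=; first by move=> x _; exact: cst_continuous.
split=> [x _|v]; first exact: differentiable_cst.
have -> : (fun x => 'D_v (fun=> a) x) = (fun=> 0).
  by apply/funext => x; exact: derive_cst.
exact: IH.
Qed.

Lemma Ck_on_postlin V W k U (L : {linear V -> W}) (F : 'rV[R]_n -> V) :
  open U -> continuous L -> Ck_on k U F -> Ck_on k U (L \o F).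
Proof.
move=> oU cL; elim: k F => [|k IH] F /=.
  by move=> H x /H ?; apply: continuous_comp => //; exact: cL.
move=> [dF H]; have dL y : differentiable L y by exact: linear_differentiable.
split=> [x /dF ?|v]; first exact: differentiable_comp.
apply: Ck_on_eq oU _ (IH _ (H v)) => x; rewrite inE => /dF dFx /=.
by rewrite derive_postlin.
Qed.

Lemma Ck_onD V k U (F G : 'rV[R]_n -> V) : open U ->
  Ck_on k U F -> Ck_on k U G -> Ck_on k U (fun x => F x + G x).
Proof.
move=> oU; elim: k F G => [|k IH] F G /=.
  by move=> H K x Ux; apply: continuousD; [exact: H|exact: K].
move=> [dF H] [dG K]; split=> [x Ux|v].
  by apply: differentiableD; [exact: dF|exact: dG].
apply: Ck_on_eq oU _ (IH _ _ (H v) (K v)) => x; rewrite inE => Ux /=.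
have dFx := dF x Ux; have dGx := dG x Ux.
by rewrite (deriveD (diff_derivable dFx) (diff_derivable dGx)).
Qed.

Lemma Ck_on_sum V k U m (F : 'I_m -> 'rV[R]_n -> V) : open U ->
  (forall j, Ck_on k U (F j)) -> Ck_on k U (fun x => \sum_(j < m) F j x).
Proof.
move=> oU; elim: m F => [|m IH] F H.
  rewrite (_ : (fun x => _) = fun=> 0); first exact: Ck_on_cst.
  by apply/funext => x; rewrite big_ord0.
have -> : (fun x => \sum_(j < m.+1) F j x)
    = fun x => F ord0 x + \sum_(j < m) F (lift ord0 j) x.
  by apply/funext => x; rewrite big_ord_recl.
by apply: Ck_onD => //; exact: IH.
Qed.

Lemma Ck_onZ V k U (a : 'rV[R]_n -> R) (F : 'rV[R]_n -> V) : open U ->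
  Ck_on k U a -> Ck_on k U F -> Ck_on k U (fun x => a x *: F x).
Proof.
move=> oU; elim: k a F => [|k IH] a F.
  by move=> H K x Ux; apply: continuousZ; [exact: H|exact: K].
move=> Ca CF; have [da H] := Ca; have [dF K] := CF; split=> [x Ux|v].
  by have [] := diff_scale (da x Ux) (dF x Ux).
have Ca' := Ck_on_lower Ca; have CF' := Ck_on_lower CF.
have C := Ck_onD oU (IH _ _ Ca' (K v)) (IH _ _ (H v) CF').
apply: Ck_on_eq oU _ C => x; rewrite inE => Ux /=.
by rewrite (derive_scale v (da x Ux) (dF x Ux)).
Qed.
End CkCalculus.

Section CkComp.
Context {R : realType} {m n : nat} {V : normedModType R}.

Lemma diff_delta (F : 'rV[R]_m -> V) x v : differentiable F x ->
  'd F x v = \sum_(j < m) v 0 j *: 'D_(delta_mx 0 j) F x.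
Proof.
move=> dF; rewrite [in LHS](row_sum_delta v) linear_sum.
by apply: eq_bigr => j _; rewrite linearZ /= deriveE.
Qed.

Definition row_coord (j : 'I_m) (v : 'rV[R]_m) : R := v 0 j.
Lemma row_coord_linear j : linear (row_coord j).
Proof. by move=> a u v; rewrite /row_coord !mxE. Qed.
HB.instance Definition _ j :=
  GRing.isLinear.Build R 'rV[R]_m R _ (row_coord j) (row_coord_linear j).

(** By induction on [k]: the derivative of [F \o G] along [v] is the sum over
[j] of the [j]th coordinate of ['D_v G] times ['D_(delta_mx 0 j) F \o G], to
which the product rule and the induction hypothesis apply. *)
Lemma Ck_on_comp k (U : set 'rV[R]_n) (W : set 'rV[R]_m)
    (G : 'rV[R]_n -> 'rV[R]_m) (F : 'rV[R]_m -> V) :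
  open U -> (forall x, U x -> W (G x)) ->
  Ck_on k U G -> Ck_on k W F -> Ck_on k U (F \o G).
Proof.
move=> oU UW; elim: k F G UW => [|k IH] F G UW.
  move=> H K x Ux; apply: continuous_comp; first exact: H.
  by apply: K; exact: UW.
move=> CG CF; have [dG HG] := CG; have [dF HF] := CF.
split=> [x Ux|v]; first by apply: differentiable_comp; [exact: dG|exact/dF/UW].
have C : Ck_on k U (fun x =>
    \sum_(j < m) row_coord j ('D_v G x) *: ('D_(delta_mx 0 j) F \o G) x).
  apply: Ck_on_sum => // j; apply: Ck_onZ => //.
    pose L : {linear 'rV[R]_m -> R} := row_coord j.
    have cL := @linear_continuous_rV R m R L.
    exact: (@Ck_on_postlin _ _ _ _ k U L ('D_v G) oU cL (HG v)).
  exact: (IH _ _ UW (Ck_on_lower CG) (HF _)).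
apply: Ck_on_eq oU _ C => x; rewrite inE => Ux /=.
have dGx := dG x Ux; have dFx := dF _ (UW x Ux).
by rewrite (derive_comp v dGx dFx) diff_delta.
Qed.
End CkComp.

(** * Germs of smooth maps *)

Section SmoothNear.
Context {R : realType} {n : nat}.
Implicit Types (V W : normedModType R) (x : 'rV[R]_n).

Lemma smooth_near_diff V x (F : 'rV[R]_n -> V) :
  smooth_near x F -> differentiable F x.
Proof. by move=> [U [_ Ux /(_ 1)[dF _]]]; exact: dF. Qed.

Lemma near_smooth_near V x (F : 'rV[R]_n -> V) :
  smooth_near x F -> \forall y \near x, smooth_near y F.
Proof.
move=> [U [oU Ux sF]]; have : nbhs x U by exact: open_nbhs_nbhs.
by apply: filterS => y Uy; exists U.
Qed.

Lemma smooth_near_eq V x (F G : 'rV[R]_n -> V) :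
  (\near x, F x = G x) -> smooth_near x F -> smooth_near x G.
Proof.
move=> FG [U [oU Ux sF]]; have oI := @open_interior _ [set y | F y = G y].
exists (U `&` [set y | F y = G y]^°); split; [exact: openI|by []|].
move=> k; apply: (@Ck_on_eq _ _ _ _ _ F); first exact: openI.
  by move=> y; rewrite inE => -[_ /interior_subset].
by apply: Ck_on_sub (sF k) => y [].
Qed.

Lemma smooth_near_ext V x (F G : 'rV[R]_n -> V) :
  F =1 G -> smooth_near x F -> smooth_near x G.
Proof. by move=> /funext ->. Qed.

Lemma smooth_near_cst V x (a : V) : smooth_near x (fun=> a).
Proof.
by exists setT; split=> //; [exact: openT|move=> k; exact: Ck_on_cst].
Qed.

Lemma smooth_near_id x : smooth_near x id.
Proof.
exists setT; split=> //; [exact: openT|move=> [|k] /=].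
  by move=> y _; exact: cvg_id.
split=> [y _|v]; first by apply: ex_diff.
have -> : (fun y : 'rV[R]_n => 'D_v id y) = (fun=> v).
  by apply/funext => y; exact: derive_id.
exact: Ck_on_cst.
Qed.

Lemma smooth_near_postlin V W x (L : {linear V -> W}) (F : 'rV[R]_n -> V) :
  continuous L -> smooth_near x F -> smooth_near x (fun y => L (F y)).
Proof.
move=> cL [U [oU Ux sF]]; exists U; split=> // k.
exact: (@Ck_on_postlin _ _ _ _ k U L F).
Qed.

Lemma smooth_nearD V x (F G : 'rV[R]_n -> V) :
  smooth_near x F -> smooth_near x G -> smooth_near x (fun y => F y + G y).
Proof.
move=> [U [oU Ux sF]] [U' [oU' Ux' sG]]; exists (U `&` U').
have oI : open (U `&` U') by exact: openI.
split=> // k.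
by apply: Ck_onD oI (Ck_on_sub _ (sF k)) (Ck_on_sub _ (sG k)) => y [].
Qed.

Lemma smooth_nearZ V x (a : 'rV[R]_n -> R) (F : 'rV[R]_n -> V) :
  smooth_near x a -> smooth_near x F -> smooth_near x (fun y => a y *: F y).
Proof.
move=> [U [oU Ux sF]] [U' [oU' Ux' sG]]; exists (U `&` U').
have oI : open (U `&` U') by exact: openI.
split=> // k.
by apply: Ck_onZ oI (Ck_on_sub _ (sF k)) (Ck_on_sub _ (sG k)) => y [].
Qed.

Lemma smooth_near_sum V x m (F : 'I_m -> 'rV[R]_n -> V) :
  (forall j, smooth_near x (F j)) ->
  smooth_near x (fun y => \sum_(j < m) F j y).
Proof.
elim: m F => [|m IH] F H.
  by apply: smooth_near_ext (smooth_near_cst x 0) => y; rewrite big_ord0.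
have H' := IH _ (fun j => H (lift ord0 j)).
apply: smooth_near_ext (smooth_nearD (H ord0) H') => y.
by rewrite big_ord_recl.
Qed.

Lemma smooth_near_derive V x v (F : 'rV[R]_n -> V) :
  smooth_near x F -> smooth_near x ('D_v F).
Proof.
by move=> [U [oU Ux sF]]; exists U; split=> // k; have [_] := sF k.+1; exact.
Qed.

End SmoothNear.

Section SmoothNearComp.
Context {R : realType} {m n : nat} {V : normedModType R}.
Implicit Types (F : 'rV[R]_m -> V) (G w : 'rV[R]_n -> 'rV[R]_m) (x : 'rV[R]_n).

Lemma smooth_near_comp x F G :
  smooth_near x G -> smooth_near (G x) F -> smooth_near x (fun y => F (G y)).
Proof.
move=> [U [oU Ux sG]] [W [oW Wx sF]].
have cG y : U y -> {for y, continuous G} by exact: (sG 0).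
pose U' := U `&` (G @^-1` W).
have oU' : open U'.
  rewrite openE => y [Uy Wy].
  have NU : nbhs y U := open_nbhs_nbhs (conj oU Uy).
  have NW : nbhs y (G @^-1` W) := cG y Uy _ (open_nbhs_nbhs (conj oW Wy)).
  exact: filterI NU NW.
exists U'; split=> // k; apply: (@Ck_on_comp _ _ _ _ k U' W G F) => //.
  by move=> y [].
by apply: Ck_on_sub (sG k) => y [].
Qed.

(** The differential of [F] applied to a vector that varies with the point is
smooth too: this is how the components of a tangent vector transform between
charts. *)
Lemma smooth_near_diffapp x F G w :
  smooth_near x G -> smooth_near x w -> smooth_near (G x) F ->
  smooth_near x (fun y => 'd F (G y) (w y)).
Proof.
move=> sG sw sF.
have cG : {for x, continuous G}.
  exact/differentiable_continuous/smooth_near_diff.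
have nF : \forall y \near x, smooth_near (G y) F.
  exact: (cG _ (near_smooth_near sF)).
have S : smooth_near x (fun y =>
    \sum_(j < m) row_coord j (w y) *: 'D_(delta_mx 0 j) F (G y)).
  apply: smooth_near_sum => j; apply: smooth_nearZ.
    exact: (smooth_near_postlin (@linear_continuous_rV R m R (row_coord j)) sw).
  exact: smooth_near_comp sG (smooth_near_derive _ sF).
apply: smooth_near_eq S; move: nF; apply: filterS => y sFy.
by rewrite diff_delta //; exact: smooth_near_diff.
Qed.

End SmoothNearComp.

Section SmoothRow.
Context {R : realType} {n a b : nat}.
Implicit Types (x : 'rV[R]_n) (F : 'rV[R]_n -> 'rV[R]_a).
Implicit Types (G : 'rV[R]_n -> 'rV[R]_b).

Lemma smooth_near_linear m x (L : {linear 'rV[R]_n -> 'rV[R]_m}) :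
  smooth_near x L.
Proof.
exact: (smooth_near_postlin (@linear_continuous_rV R n _ L) (smooth_near_id x)).
Qed.

Lemma smooth_near_row x F G :
  smooth_near x F -> smooth_near x G ->
  smooth_near x (fun y => row_mx (F y) (G y)).
Proof.
move=> sF sG.
pose A : {linear 'rV[R]_a -> 'rV[R]_(a + b)} := mulmxr (row_mx 1%:M 0).
pose B : {linear 'rV[R]_b -> 'rV[R]_(a + b)} := mulmxr (row_mx 0 1%:M).
apply: (@smooth_near_ext _ _ _ _ (fun y => A (F y) + B (G y))).
  move=> y; rewrite /= !mul_mx_row !mulmx1 !mulmx0 add_row_mx.
  by rewrite addr0 add0r.
apply: smooth_nearD.
  exact: (smooth_near_postlin (@linear_continuous_rV R _ _ A)).
exact: (smooth_near_postlin (@linear_continuous_rV R _ _ B)).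
Qed.

End SmoothRow.

(** * Charts and tangent vectors *)

Section Charts.
Context {R : realType} {n : nat}.

Lemma local_repE_inj (M : atlas R n) (V : normedModType R) (i : index M)
    (F : M -> V) p :
  {in dom i &, injective (chart i)} -> dom i p ->
  local_rep i F (chart i p) = F p.
Proof.
move=> inj ip; rewrite /local_rep.
case: xgetP => [y _ [q [iq /= qp] <-]|/(_ (F p))].
  by congr F; apply: inj; rewrite ?inE.
by case; exists p.
Qed.

(** The local calculus rests on these properties of the charts, which pass from
a manifold to its tangent bundle. *)
Record compatible_charts (M : atlas R n) : Prop := CompatibleCharts {
  cc_inj : forall i : index M, {in dom i &, injective (chart i)};
  cc_open : forall i j : index M, open (chart i @` (dom i `&` dom j));
  cc_smooth : forall (i j : index M) p, dom i p -> dom j p ->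
    smooth_near (chart i p) (local_rep i (chart j)) }.

Lemma manifold_compatible (M : atlas R n) :
  smooth_manifold M -> compatible_charts M.
Proof.
move=> sM; split; [exact: atlas_inj|exact: atlas_open|] => i j p ip jp.
by exists (chart i @` (dom i `&` dom j)); split;
  [exact: atlas_open|exists p|exact: atlas_smooth].
Qed.

Context {M : atlas R n}.
Hypothesis cM : compatible_charts M.
Implicit Types (i j k : index M) (p q : M) (V : normedModType R).

Lemma chart_inj i p q : dom i p -> dom i q -> chart i p = chart i q -> p = q.
Proof. by move=> ip iq; apply: (cc_inj cM (i := i)); rewrite inE. Qed.

Lemma local_repE V i (F : M -> V) p :
  dom i p -> local_rep i F (chart i p) = F p.
Proof. exact: local_repE_inj (cc_inj cM (i := i)). Qed.

(** [A] contains all the points of the chart domain near [p].  Quantifying over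
the image of the chart keeps the statement inside the row vector space, since
the carrier has no topology. *)
Definition chart_nbhs i p (A : set M) :=
  \forall z \near chart i p, exists q, [/\ dom i q, A q & z = chart i q].

Lemma chart_nbhs_dom i j p : dom i p -> dom j p -> chart_nbhs i p (dom j).
Proof.
move=> ip jp; have : nbhs (chart i p) (chart i @` (dom i `&` dom j)).
  by rewrite nbhsE; exists (chart i @` (dom i `&` dom j)) => //;
    split; [exact: (cc_open cM)|exists p].
by apply: filterS => z [q [iq jq] <-]; exists q.
Qed.

Lemma chart_nbhsT i p : dom i p -> chart_nbhs i p setT.
Proof.
move=> ip; have := chart_nbhs_dom ip ip; rewrite /chart_nbhs.
by apply: filterS => z [q [iq _ ->]]; exists q.
Qed.

(** Smoothness at [p] tested in the single chart [i], as opposed to all charts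
around [p]. *)
Definition smooth_in V i (F : M -> V) p :=
  smooth_near (chart i p) (local_rep i F).

(** Every smoothness proof in a chart comes down to exhibiting a smooth map [H]
that represents [F] near [p]. *)
Lemma smooth_in_rep V i p A (H : 'rV[R]_n -> V) (F : M -> V) :
  chart_nbhs i p A -> (forall q, dom i q -> A q -> H (chart i q) = F q) ->
  smooth_near (chart i p) H -> smooth_in i F p.
Proof.
move=> nA HF; apply: smooth_near_eq; move: nA; rewrite /chart_nbhs.
by apply: filterS => z [q [iq Aq ->]]; rewrite local_repE // HF.
Qed.

Lemma smooth_in_eq V i p A (F G : M -> V) : chart_nbhs i p A ->
  (forall q, dom i q -> A q -> F q = G q) -> smooth_in i F p -> smooth_in i G p.
Proof.
by move=> nA FG; apply: (smooth_in_rep nA) => q iq Aq; rewrite local_repE // FG.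
Qed.

Lemma smooth_inD V i p (F G : M -> V) : dom i p ->
  smooth_in i F p -> smooth_in i G p -> smooth_in i (fun q => F q + G q) p.
Proof.
move=> ip sF sG; apply: (smooth_in_rep (chart_nbhsT ip)) (smooth_nearD sF sG).
by move=> q iq _; rewrite !local_repE.
Qed.

Lemma smooth_inZ V i p (a : M -> R) (F : M -> V) : dom i p ->
  smooth_in i a p -> smooth_in i F p -> smooth_in i (fun q => a q *: F q) p.
Proof.
move=> ip sF sG; apply: (smooth_in_rep (chart_nbhsT ip)) (smooth_nearZ sF sG).
by move=> q iq _; rewrite !local_repE.
Qed.

Lemma smooth_in_cst V i p (a : V) : dom i p -> smooth_in i (fun=> a) p.
Proof.
by move=> ip; apply: (smooth_in_rep (chart_nbhsT ip)) (smooth_near_cst _ a).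
Qed.

Lemma smooth_in_sum V i p m (F : 'I_m -> M -> V) : dom i p ->
  (forall l, smooth_in i (F l) p) ->
  smooth_in i (fun q => \sum_(l < m) F l q) p.
Proof.
move=> ip sF; apply: (smooth_in_rep (chart_nbhsT ip)) (smooth_near_sum sF).
by move=> q iq _; apply: eq_bigr => l _; rewrite local_repE.
Qed.

Lemma smooth_in_lin m V i p (L : {linear 'rV[R]_m -> V}) (F : M -> 'rV[R]_m) :
  dom i p -> smooth_in i F p -> smooth_in i (fun q => L (F q)) p.
Proof.
move=> ip sF; apply: (smooth_in_rep (chart_nbhsT ip))
  (smooth_near_postlin (@linear_continuous_rV R _ _ L) sF).
by move=> q iq _; rewrite !local_repE.
Qed.

Lemma smooth_in_row a b i p (F : M -> 'rV[R]_a) (G : M -> 'rV[R]_b) :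
  dom i p -> smooth_in i F p -> smooth_in i G p ->
  smooth_in i (fun q => row_mx (F q) (G q)) p.
Proof.
move=> ip sF sG.
apply: (smooth_in_rep (chart_nbhsT ip)) (smooth_near_row sF sG).
by move=> q iq _; rewrite !local_repE.
Qed.

Lemma smooth_in_chart i p : dom i p -> smooth_in i (chart i) p.
Proof.
by move=> ip; apply: (smooth_in_rep (chart_nbhsT ip)) (smooth_near_id _).
Qed.

Lemma smooth_in_change V i j p (F : M -> V) : dom i p -> dom j p ->
  smooth_in i F p -> smooth_in j F p.
Proof.
move=> ip jp sF; have sC := cc_smooth cM jp ip.
have nA := chart_nbhs_dom jp ip.
have sF' : smooth_near (local_rep j (chart i) (chart j p)) (local_rep i F).
  by rewrite local_repE.
apply: (smooth_in_rep nA) (smooth_near_comp sC sF') => q jq iq.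
by rewrite (local_repE _ jq) local_repE.
Qed.

(** The chain rule for the change of charts from [i] to [j].  With another
chart for [F] it is the cocycle condition on the transition maps. *)
Lemma diff_change V i j p (F : M -> V) (v : 'rV[R]_n) : dom i p -> dom j p ->
  smooth_in i F p ->
  'd (local_rep j F) (chart j p) ('d (local_rep i (chart j)) (chart i p) v)
    = 'd (local_rep i F) (chart i p) v.
Proof.
move=> ip jp sF; have sC := cc_smooth cM ip jp.
have sFj := smooth_in_change ip jp sF.
have dC := smooth_near_diff sC.
have E : local_rep i (chart j) (chart i p) = chart j p by rewrite local_repE.
apply: (diff_comp_near v E dC (smooth_near_diff sFj)).
have := chart_nbhs_dom ip jp; rewrite /chart_nbhs.
apply: filterS => z [q [iq jq ->]] /=.
by rewrite (local_repE _ iq) !local_repE.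
Qed.

Lemma diff_chart_id i p (v : 'rV[R]_n) : dom i p ->
  'd (local_rep i (chart i)) (chart i p) v = v.
Proof.
move=> ip; have nE : \forall z \near chart i p, id z = local_rep i (chart i) z.
  have := chart_nbhsT ip; rewrite /chart_nbhs.
  apply: filterS => z [q [iq _ ->]].
  by rewrite local_repE.
have di : is_diff (chart i p) (@id 'rV[R]_n) id by exact: is_diff_id.
have [_ ->] := near_eq_diff nE (@ex_diff _ _ _ _ _ _ _ di).
by rewrite (@diff_val _ _ _ _ _ _ _ di).
Qed.

Lemma tangent_change p (v : tangent p) i j : dom i p -> dom j p ->
  v j = 'd (local_rep i (chart j)) (chart i p) (v i).
Proof. by case: v => v /= /asboolP[_ H] ip jp; exact: H. Qed.

Lemma tangent_out p (v : tangent p) i : ~ dom i p -> v i = 0.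
Proof. by case: v => v /= /asboolP[H _] ip; exact: H. Qed.

(** One chart determines a tangent vector, because the components in the other
charts are the images of those in the first by the differentials of the
transition maps. *)
Lemma tangent_ext p (v w : tangent p) i : dom i p -> v i = w i -> v = w.
Proof.
move=> ip E; apply: val_inj; apply/funext => j.
have [jp|jp] := pselect (dom j p).
  by rewrite /= (tangent_change v ip jp) (tangent_change w ip jp) E.
by rewrite /= !tangent_out.
Qed.

Lemma tangentD p (v w : tangent p) i : (v + w) i = v i + w i.
Proof. by []. Qed.
Lemma tangentZ p a (v : tangent p) i : (a *: v) i = a *: v i.
Proof. by []. Qed.
Lemma tangent0 p i : (0 : tangent p) i = 0.
Proof. by []. Qed.
Lemma tangent_sum p i m (v : 'I_m -> tangent p) :
  (\sum_(l < m) v l) i = \sum_(l < m) v l i.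
Proof.
by apply: (@big_morph _ _ (fun v : tangent p => v i) 0 +%R 0 +%R).
Qed.

(** Conversely any row vector is the vector of components of a tangent vector,
by the cocycle condition. *)
Lemma tangent_exists i p (w : 'rV[R]_n) :
  dom i p -> exists v : tangent p, v i = w.
Proof.
move=> ip.
pose v j :=
  if pselect (dom j p) then 'd (local_rep i (chart j)) (chart i p) w else 0.
have vE j : dom j p -> v j = 'd (local_rep i (chart j)) (chart i p) w.
  by rewrite /v; case: pselect.
have vT : v \in tangent_pred p.
  apply/asboolP; split=> [j jp|j k jp kp]; first by rewrite /v; case: pselect.
  rewrite (vE _ jp) (vE _ kp); apply: esym.
  exact: (diff_change w ip jp (cc_smooth cM ip kp)).
by exists (Tangent vT); rewrite /= (vE _ ip); exact: diff_chart_id.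
Qed.

(** For fixed [w] this is the constant field with components [w] in the chart
[i]; it is extended by zero so as to be defined on the whole manifold. *)
Definition chart_vec i p (w : 'rV[R]_n) : tangent p :=
  xget 0 [set v : tangent p | dom i p /\ v i = w].

Lemma chart_vecE i p w : dom i p -> chart_vec i p w i = w.
Proof.
move=> ip; rewrite /chart_vec; case: xgetP => [v _ []//|].
by have [v vi] := tangent_exists w ip; move=> /(_ v); case.
Qed.

Lemma chart_vec_out i p w : ~ dom i p -> chart_vec i p w = 0.
Proof. by move=> ip; rewrite /chart_vec; case: xgetP => // v _ [/ip]. Qed.

Lemma tangent_expand i p (x : tangent p) : dom i p ->
  x = \sum_(l < n) row_coord l (x i) *: chart_vec i p (delta_mx 0 l).
Proof.
move=> ip; apply: (tangent_ext ip); rewrite tangent_sum [LHS]row_sum_delta.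
by apply: eq_bigr => l _; rewrite tangentZ chart_vecE.
Qed.

Lemma smooth_funP (V : normedModType R) i p (F : M -> V) : dom i p ->
  smooth_fun_at F p <-> smooth_in i F p.
Proof.
by move=> ip; split=> [|sF j jp]; [exact|exact: (smooth_in_change ip)].
Qed.

Lemma smooth_vfieldP i p (X : vfield M) : dom i p ->
  smooth_vfield_at X p <-> smooth_in i (fun q => X q i) p.
Proof.
move=> ip; split=> [|sX j jp]; first exact.
have sXj := smooth_in_change ip jp sX.
have nA := chart_nbhs_dom jp ip.
have sC := cc_smooth cM jp ip.
have sC' :
    smooth_near (local_rep j (chart i) (chart j p)) (local_rep i (chart j)).
  by rewrite local_repE //; exact: (cc_smooth cM).
apply: (smooth_in_rep nA) (smooth_near_diffapp sC sXj sC') => q jq iq.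
by rewrite (local_repE _ jq) local_repE // -tangent_change.
Qed.

(** [dfun] chooses some chart around [p]; the chain rule makes the choice
irrelevant. *)
Lemma dfunE i p (F : M -> R) (x : tangent p) : dom i p -> smooth_in i F p ->
  dfun F x = 'd (local_rep i F) (chart i p) (x i).
Proof.
move=> ip sF; rewrite /dfun; case: xgetP => [y _ [j [jp ->]]|].
  by rewrite (tangent_change x ip jp); exact: diff_change.
by move=> /(_ ('d (local_rep i F) (chart i p) (x i))); case; exists i.
Qed.

End Charts.

Section DiffLocalRep.
Context {R : realType} {n : nat} {M : atlas R n}.
Hypothesis cM : compatible_charts M.
Implicit Types (i : index M) (p : M).

Lemma diff_local_rep_lin m (V : normedModType R) i p
    (L : {linear 'rV[R]_m -> V}) (F : M -> 'rV[R]_m) v :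
  dom i p -> smooth_in i F p ->
  'd (local_rep i (fun q => L (F q))) (chart i p) v
    = L ('d (local_rep i F) (chart i p) v).
Proof.
move=> ip sF; have cL := @linear_continuous_rV R m V L.
have dL : differentiable L (F p) by exact: linear_differentiable.
have E : local_rep i F (chart i p) = F p by rewrite local_repE.
rewrite -(diff_comp_near v E (smooth_near_diff sF) dL) ?(diff_lin (F p) cL) //.
have := chart_nbhsT cM ip; rewrite /chart_nbhs.
apply: filterS => z [q [iq _ ->]].
by rewrite !(local_repE cM _ iq).
Qed.

Lemma diff_local_rep_row a b i p (F : M -> 'rV[R]_a) (G : M -> 'rV[R]_b) v :
  dom i p -> smooth_in i F p -> smooth_in i G p ->
  'd (local_rep i (fun q => row_mx (F q) (G q))) (chart i p) v
    = row_mx ('d (local_rep i F) (chart i p) v)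
             ('d (local_rep i G) (chart i p) v).
Proof.
move=> ip sF sG; have sFG := smooth_in_row cM ip sF sG.
rewrite -[LHS]hsubmxK; congr row_mx.
  rewrite -(diff_local_rep_lin lsubmx v ip sFG).
  suff -> : (fun q => lsubmx (row_mx (F q) (G q))) = F by [].
  by apply/funext => q; rewrite row_mxKl.
rewrite -(diff_local_rep_lin rsubmx v ip sFG).
suff -> : (fun q => rsubmx (row_mx (F q) (G q))) = G by [].
by apply/funext => q; rewrite row_mxKr.
Qed.

End DiffLocalRep.

(** * Charts of the tangent bundle *)

Section TangentBundleCharts.
Context {R : realType} {n : nat} {M : atlas R n}.
Hypothesis cM : compatible_charts M.
Local Notation TM := (tangent_bundle M).

Lemma tchart_inj (i : index TM) :
  {in @dom _ _ TM i &, injective (@chart _ _ TM i)}.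
Proof.
move=> [p v] [q w]; rewrite !inE /=.
move=> ip iq /eq_row_mx[/(chart_inj cM ip iq) pq].
by case: q / pq w iq => w _ vw; rewrite (tangent_ext ip vw).
Qed.

(** The image of an overlap by a chart of the tangent bundle is a product with
the whole fibre, because every row vector is the component vector of some
tangent vector.  Openness of overlaps is inherited through this equality. *)
Lemma tchart_imageE (i j : index M) :
  @chart _ _ TM i @` (@dom _ _ TM i `&` @dom _ _ TM j)
    = lsubmx @^-1` (chart i @` (dom i `&` dom j)).
Proof.
apply/seteqP; split=> [_ [[p v] [/= ip jp] <-]|z [p [ip jp] zp]].
  by exists p => //=; rewrite row_mxKl.
have [v vE] := tangent_exists cM (rsubmx z) ip.
by exists (existT _ p v) => //=; rewrite vE zp hsubmxK.
Qed.

(** The transition maps of the tangent bundle are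
[(z, w) |-> (phi z, 'd phi z w)], smooth because [phi] is. *)
Lemma tangent_bundle_compatible : compatible_charts TM.
Proof.
have op i j : open (@chart _ _ TM i @` (@dom _ _ TM i `&` @dom _ _ TM j)).
  rewrite tchart_imageE; apply: open_comp; last exact: (cc_open cM).
  by move=> z _; exact: continuous_lsubmx.
split; [exact: tchart_inj|exact: op|] => i j u iu ju.
pose phi := @local_rep _ _ M _ i (@chart _ _ M j).
pose H (z : 'rV[R]_(n + n)) :=
  row_mx (phi (lsubmx z)) ('d phi (lsubmx z) (rsubmx z)).
have sphi : smooth_near (lsubmx (@chart _ _ TM i u)) phi.
  by rewrite /= row_mxKl; exact: (cc_smooth cM).
have sl : smooth_near (@chart _ _ TM i u) lsubmx.
  exact: (smooth_near_linear _ lsubmx).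
have sr : smooth_near (@chart _ _ TM i u) rsubmx.
  exact: (smooth_near_linear _ rsubmx).
have sH : smooth_near (@chart _ _ TM i u) H.
  apply: smooth_near_row (smooth_near_comp sl sphi) _.
  exact: smooth_near_diffapp sl sr sphi.
apply: smooth_near_eq sH.
set W := @chart _ _ TM i @` (@dom _ _ TM i `&` @dom _ _ TM j).
have : nbhs (@chart _ _ TM i u) W.
  by rewrite nbhsE; exists W => //; split; [exact: op|exists u].
apply: filterS => _ [[p v] [/= ip jp] <-].
have E := local_repE_inj (@chart _ _ TM j) (@tchart_inj i)
  (ip : @dom _ _ TM i (existT _ p v)).
rewrite [RHS]E /H /= row_mxKl row_mxKr /phi (local_repE cM _ ip).
by rewrite -(tangent_change v ip jp).
Qed.

Lemma smooth_in_proj (V : normedModType R) (i : index M) (u : TM) (F : M -> V) :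
  dom i (tag u) -> smooth_in i F (tag u) ->
  smooth_in (M := TM) i (fun u' => F (tag u')) u.
Proof.
have cT := tangent_bundle_compatible.
move=> iu sF; have sl : smooth_near (@chart _ _ TM i u) lsubmx.
  exact: (smooth_near_linear _ lsubmx).
have sF' : smooth_near (lsubmx (@chart _ _ TM i u)) (local_rep i F).
  by rewrite /= row_mxKl.
apply: (smooth_in_rep cT (chart_nbhsT cT iu)) (smooth_near_comp sl sF').
by move=> u' iu' _; rewrite /= row_mxKl local_repE.
Qed.

(** The fibre coordinates of the tautological point [u'] of the bundle are the
last [n] coordinates of its chart. *)
Lemma smooth_in_fiber (i : index M) (u : TM) : dom i (tag u) ->
  smooth_in (M := TM) i (fun u' => tagged u' i) u.
Proof.
have cT := tangent_bundle_compatible.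
move=> iu; apply: (smooth_in_rep cT (chart_nbhsT cT iu))
  (smooth_near_linear _ rsubmx) => u' iu' _.
by rewrite /= row_mxKr.
Qed.

End TangentBundleCharts.

(** * Connections in a chart *)

Section Connection.
Context {R : realType} {n : nat} {M : atlas R n}.
Hypothesis cM : compatible_charts M.
Implicit Types (i : index M) (p q : M).

Lemma smooth_vfieldD (X Y : vfield M) p :
  smooth_vfield_at X p -> smooth_vfield_at Y p ->
  smooth_vfield_at (fun q => X q + Y q) p.
Proof. by move=> sX sY i ip; exact: (smooth_inD cM ip (sX i ip) (sY i ip)). Qed.

Lemma smooth_vfieldZ (F : M -> R) (X : vfield M) p :
  smooth_fun_at F p -> smooth_vfield_at X p ->
  smooth_vfield_at (fun q => F q *: X q) p.
Proof. by move=> sF sX i ip; exact: (smooth_inZ cM ip (sF i ip) (sX i ip)). Qed.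

Lemma smooth_vfield0 p : smooth_vfield_at (fun q : M => 0 : tangent q) p.
Proof. by move=> i ip; exact: (smooth_in_cst cM _ ip). Qed.

Lemma smooth_vfield_sum m (X : 'I_m -> vfield M) p :
  (forall l, smooth_vfield_at (X l) p) ->
  smooth_vfield_at (fun q => \sum_(l < m) X l q) p.
Proof.
elim: m X => [|m IH] X sX.
  have -> : (fun q : M => \sum_(l < 0) X l q) = fun q => 0.
    by apply: functional_extensionality_dep => q; rewrite big_ord0.
  exact: smooth_vfield0.
have -> : (fun q : M => \sum_(l < m.+1) X l q)
    = fun q => X ord0 q + \sum_(l < m) X (lift ord0 l) q.
  by apply: functional_extensionality_dep => q; rewrite big_ord_recl.
by apply: smooth_vfieldD => //; exact: IH.
Qed.

Lemma smooth_chart_vec i w p :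
  dom i p -> smooth_vfield_at (fun q => chart_vec i q w) p.
Proof.
move=> ip; apply/(smooth_vfieldP cM _ ip).
apply: (smooth_in_eq cM (chart_nbhsT cM ip)) (smooth_in_cst cM w ip).
by move=> q iq _; rewrite (chart_vecE cM).
Qed.

Context {D : covariant_derivative M}.
Hypothesis cD : is_connection D.

Lemma conn0 p (x : tangent p) : D x (fun q => 0) = 0.
Proof.
have s0 : smooth_vfield_at (fun q : M => 0 : tangent q) p := @smooth_vfield0 p.
have sF : smooth_fun_at (fun _ : M => 0 : R) p.
  by move=> i ip; exact: (smooth_in_cst cM _ ip).
have := conn_leibniz cD x sF s0; rewrite scaler0 scale0r addr0 => <-.
by congr (D x); apply: functional_extensionality_dep => q; rewrite scaler0.
Qed.

Lemma conn_sum m p (x : tangent p) (X : 'I_m -> vfield M) :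
  (forall l, smooth_vfield_at (X l) p) ->
  D x (fun q => \sum_(l < m) X l q) = \sum_(l < m) D x (X l).
Proof.
elim: m X => [|m IH] X sX.
  rewrite big_ord0 -(conn0 x); congr (D x).
  by apply: functional_extensionality_dep => q; rewrite big_ord0.
rewrite big_ord_recl -IH // -conn_add //; last exact: smooth_vfield_sum.
by congr (D x); apply: functional_extensionality_dep => q; rewrite big_ord_recl.
Qed.

(** The Christoffel form of the connection: the components of the covariant
derivative along [x] of the field that is constant, equal to [w], in the
chart.  It is written so as to be visibly linear in [w]. *)
Definition christoffel i p (x : tangent p) (w : 'rV[R]_n) : 'rV[R]_n :=
  \sum_(l < n) row_coord l w *: D x (fun q => chart_vec i q (delta_mx 0 l)) i.

Lemma christoffelP i p a (x y : tangent p) w : dom i p ->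
  christoffel i (a *: x + y) w = a *: christoffel i x w + christoffel i y w.
Proof.
move=> ip; rewrite /christoffel scaler_sumr -big_split; apply: eq_bigr => l _.
have := conn_linear cD (smooth_chart_vec (delta_mx 0 l) ip) => /= ->.
by rewrite tangentD tangentZ scalerDr !scalerA [a * _]mulrC.
Qed.

Lemma christoffel0 i p w : dom i p -> christoffel i (0 : tangent p) w = 0.
Proof.
move=> ip; have := christoffelP (-1) 0 (0 : tangent p) w ip.
by rewrite scaler0 addr0 scaleN1r addNr.
Qed.

(** The Leibniz rule is required for all functions smooth near [p], including
the indicator of the chart domain, whose differential at [p] vanishes.  Hence
[s] may be replaced by its expansion in the coordinate frame extended by zero,
without any bump function, and the formula is the Leibniz rule applied to each
term. *)
Lemma conn_chart i p (x : tangent p) (s : vfield M) : dom i p ->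
  smooth_vfield_at s p ->
  D x s i = 'd (local_rep i (fun q => s q i)) (chart i p) (x i)
            + christoffel i x (s p i).
Proof.
move=> ip ss; have ssi := ss i ip.
pose F (q : M) : R := if pselect (dom i q) then 1 else 0.
have F1 q : dom i q -> F q = 1 by rewrite /F; case: pselect.
have sF : smooth_in i F p.
  have s1 : smooth_in i (fun _ : M => 1 : R) p.
    exact: (smooth_in_cst cM _ ip).
  by apply: (smooth_in_eq cM (chart_nbhsT cM ip)) s1 => q iq _; rewrite F1.
have dF : dfun F x = 0.
  rewrite (dfunE cM x ip sF).
  have nF : \forall z \near chart i p, cst 1 z = local_rep i F z.
    have := chart_nbhsT cM ip; rewrite /chart_nbhs.
    by apply: filterS => z [q [iq _ ->]]; rewrite local_repE // F1.
  have [_ ->] := near_eq_diff nF (differentiable_cst _ _).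
  by rewrite diff_cst.
pose sl l q : R := row_coord l (s q i).
have ssl l : smooth_in i (sl l) p.
  exact: (smooth_in_lin cM (row_coord l) ip ssi).
have fsl l : smooth_fun_at (sl l) p by apply/(smooth_funP cM _ ip).
have sE l := smooth_chart_vec (delta_mx 0 l) ip.
have -> : D x s =
    D x (fun q => \sum_(l < n) sl l q *: chart_vec i q (delta_mx 0 l)).
  have fF : smooth_fun_at F p by apply/(smooth_funP cM _ ip).
  have := conn_leibniz cD x fF ss; rewrite dF scale0r add0r F1 // scale1r => <-.
  congr (D x); apply: functional_extensionality_dep => q; rewrite /F.
  case: pselect => [iq|iq].
    by rewrite scale1r [LHS](tangent_expand cM _ iq).
  by rewrite scale0r big1 // => l _; rewrite (chart_vec_out _ iq) scaler0.
rewrite conn_sum; last by move=> l; apply: smooth_vfieldZ.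
rewrite tangent_sum /christoffel [X in X + _]row_sum_delta -big_split.
apply: eq_bigr => l _ /=.
rewrite (conn_leibniz cD x (fsl l) (sE l)) tangentD !tangentZ.
rewrite (chart_vecE cM _ ip).
congr (_ *: _ + _).
rewrite (dfunE cM x ip (ssl l)).
by rewrite (diff_local_rep_lin cM (row_coord l) _ ip ssi).
Qed.

(** By [conn_chart], being parallel at [p] in the direction [x] only
prescribes the derivative of the components of [s] along [x], so an affine
choice of components works. *)
Lemma parallel_section p (x u : tangent p) :
  (exists i : index M, dom i p) ->
  exists s : vfield M, [/\ smooth_vfield_at s p, s p = u & D x s = 0].
Proof.
move=> [i ip]; set w := christoffel i x (u i).
(* [B] is the derivative of the components of the parallel section; it exists
   because [w] vanishes when [x] does. *)
have [B xB] : exists B : 'M[R]_n, x i *m B = - w.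
  have [x0|x0] := eqVneq (x i) 0; last first.
    exists (pinvmx (x i) *m - w); rewrite mulmxA mulmxVp ?mul1mx //.
    by rewrite /row_free rank_rV x0.
  exists 0; rewrite mulmx0 /w.
  have -> : x = 0 by exact: (tangent_ext ip).
  by rewrite christoffel0 // oppr0.
pose a := u i - chart i p *m B.
pose s q := chart_vec i q (a + chart i q *m B).
have sE q : dom i q -> s q i = a + chart i q *m B.
  by move=> iq; rewrite /s (chart_vecE cM).
have snear : smooth_near (chart i p) (fun z => a + mulmxr B z).
  exact: smooth_nearD (smooth_near_cst _ _) (smooth_near_linear _ (mulmxr B)).
have ss : smooth_vfield_at s p.
  apply/(smooth_vfieldP cM _ ip).
  apply: (smooth_in_rep cM (chart_nbhsT cM ip) _ snear) => q iq _.
  by rewrite sE.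
have sp : s p = u by apply: (tangent_ext ip); rewrite sE // /a subrK.
exists s; split=> //; apply: (tangent_ext ip).
rewrite (conn_chart _ ip ss) sp tangent0 -/w.
have nE : \forall z \near chart i p,
    a + mulmxr B z = local_rep i (fun q => s q i) z.
  have := chart_nbhsT cM ip; rewrite /chart_nbhs.
  by apply: filterS => z [q [iq _ ->]]; rewrite local_repE // sE.
have cB :=
  @linear_continuous_rV R _ _ (mulmxr B : {linear 'rV[R]_n -> 'rV[R]_n}).
by rewrite (diff_affine_near (x i) cB nE) /= xB addNr.
Qed.
End Connection.

(** * Horizontal and vertical lifts in a chart *)

Section Lifts.
Context {R : realType} {n : nat} {M : atlas R n}.
Hypothesis cM : compatible_charts M.
Local Notation TM := (tangent_bundle M).
Let cT : compatible_charts TM := tangent_bundle_compatible cM.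
Implicit Types (i j : index M) (p q : M).

Lemma chartT_smooth_section i j (s : vfield M) p : dom i p -> dom j p ->
  smooth_vfield_at s p ->
  smooth_in i (fun q => @chart _ _ TM j (section_point s q)) p.
Proof.
move=> ip jp ss; apply: (smooth_in_change cM jp ip).
exact: (smooth_in_row cM jp (smooth_in_chart cM jp) (ss j jp)).
Qed.

(** The derivative of a vector field along [x], computed in each chart, is a
tangent vector to the tangent bundle: this compares the chain rules for the
change of charts on the base and on the bundle. *)
Lemma section_tangent (s : vfield M) p (x : tangent p) :
  (exists i : index M, dom i p) -> smooth_vfield_at s p ->
  exists X : tangent (section_point s p), forall i, dom i p ->
    X i = 'd (local_rep i (fun q => @chart _ _ TM i (section_point s q)))
             (chart i p) (x i).
Proof.
move=> [i ip] ss; set u := section_point s p.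
have [X XE] := tangent_exists cT (p := u)
  ('d (local_rep i (fun q => @chart _ _ TM i (section_point s q)))
      (chart i p) (x i))
  (ip : @dom _ _ TM i u).
exists X => j jp.
rewrite (tangent_change X (ip : @dom _ _ TM i u) (jp : @dom _ _ TM j u)) XE.
rewrite (tangent_change x ip jp).
have sSj := chartT_smooth_section ip jp ss.
apply: etrans; last exact/esym/(diff_change cM (x i) ip jp sSj).
have sC := cc_smooth cT (ip : @dom _ _ TM i u) (jp : @dom _ _ TM j u).
have sS := chartT_smooth_section ip ip ss.
apply: (diff_comp_near (x i) _ (smooth_near_diff sS) (smooth_near_diff sC)).
  by rewrite (local_repE cM _ ip).
have := chart_nbhs_dom cM ip jp; rewrite /chart_nbhs.
apply: filterS => z [q [iq jq ->]].
rewrite !(local_repE cM _ iq).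
exact: (local_repE cT (@chart _ _ TM j)
  (iq : @dom _ _ TM i (section_point s q))).
Qed.

Context {D : covariant_derivative M}.
Hypothesis cD : is_connection D.
Hypothesis covM : forall p, exists i : index M, dom i p.

(** Any section parallel along [x] through [u] has the derivative
[- christoffel i x u] there, so the horizontal lift does not depend on the
section chosen in its definition. *)
Lemma hlift_chart i (u : TM) (x : tangent (tag u)) : dom i (tag u) ->
  hlift D x i = row_mx (x i) (- christoffel (D := D) i x (tagged u i)).
Proof.
move=> iu; rewrite /hlift; case: xgetP => [X _ [s [ss su Ds XE]]|].
  rewrite (XE i iu).
  rewrite (diff_local_rep_row cM _ iu (smooth_in_chart cM iu) (ss i iu)).
  apply: f_equal2; first exact: (diff_chart_id cM _ iu).
  apply/eqP.
  by rewrite -addr_eq0 -[in christoffel _ _ _]su -(conn_chart cM cD x iu ss) Ds.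
case: u x iu => p v x iu.
have [s [ss su Ds]] := parallel_section cM cD x v (covM p).
have [X XE] := section_tangent x (covM p) ss.
case: _ / su X XE => X XE.
by move=> /(_ X); case; exists s.
Qed.

(** The velocity of such a line is a vertical lift; in every chart the line is
straight because the components are linear on the fibre. *)
Lemma fiber_line i p (v x : tangent p) (t : R) :
  @chart _ _ TM i (existT _ p (v + t *: x))
    = row_mx (chart i p) (v i) + t *: row_mx 0 (x i).
Proof. by rewrite scale_row_mx add_row_mx scaler0 addr0. Qed.

(** The transition maps of the bundle carry the lines of the fibre to lines,
hence their velocities to each other. *)
Lemma vertical_tangent p (v x : tangent p) :
  exists X : tangent (existT _ p v : TM),
  forall i, dom i p -> X i = row_mx 0 (x i).
Proof.
have [i ip] := covM p; set u : TM := existT _ p v.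
have [X XE] :=
  tangent_exists cT (p := u) (row_mx 0 (x i)) (ip : @dom _ _ TM i u).
exists X => j jp.
rewrite (tangent_change X (ip : @dom _ _ TM i u) (jp : @dom _ _ TM j u)) XE.
have [di Ei] := diff_line (row_mx (chart i p) (v i)) (row_mx 0 (x i)) (0 : R).
have [dj Ej] := diff_line (row_mx (chart j p) (v j)) (row_mx 0 (x j)) (0 : R).
rewrite -[in LHS]Ei -[RHS]Ej.
have sC := cc_smooth cT (ip : @dom _ _ TM i u) (jp : @dom _ _ TM j u).
have y0 :
    row_mx (chart i p) (v i) + (0 : R) *: row_mx 0 (x i) = @chart _ _ TM i u.
  by rewrite scale0r addr0.
apply: (diff_comp_near (1 : R) y0 di (smooth_near_diff sC)).
have lineE (t : R) : @local_rep _ _ TM _ i (@chart _ _ TM j)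
    (row_mx (chart i p) (v i) + t *: row_mx 0 (x i))
    = row_mx (chart j p) (v j) + t *: row_mx 0 (x j).
  rewrite -!fiber_line.
  exact: (local_repE cT (@chart _ _ TM j)
    (ip : @dom _ _ TM i (existT _ p (v + t *: x)))).
by near=> t; exact: lineE.
Unshelve. all: by end_near.
Qed.

Lemma vlift_chart i (u : TM) (x : tangent (tag u)) : dom i (tag u) ->
  vlift x i = row_mx 0 (x i).
Proof.
case: u x => p v x /= ip.
have vE j : derive1 (fun t : R =>
    @chart _ _ TM j (existT _ p (v + t *: x))) 0 = row_mx 0 (x j).
  under eq_fun do rewrite fiber_line.
  have [d E] := diff_line (row_mx (chart j p) (v j)) (row_mx 0 (x j)) (0 : R).
  by rewrite derive1E (deriveE _ d).
rewrite /vlift; case: xgetP => [X _ XE|]; first by rewrite (XE i ip) vE.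
have [X XE] := vertical_tangent v x.
by move=> /(_ X); case => j jp; rewrite (XE j jp) vE.
Qed.

End Lifts.

(** * Hermitian algebra of a split vector space *)

Section SplittingAlgebra.
Context {F : fieldType} {V W : lmodType F}.
Variables (H L : V -> W) (P Q : W -> V).

(** The model is the tangent space [W] of the tangent bundle at [u], with [V]
the tangent space of the base, [H] and [L] the horizontal and vertical lifts. *)
Record splitting : Prop := Splitting {
  spl_H : linear H; spl_L : linear L; spl_P : linear P; spl_Q : linear Q;
  spl_PH : cancel H P; spl_PL : forall x, P (L x) = 0;
  spl_QH : forall x, Q (H x) = 0; spl_QL : cancel L Q;
  spl_sum : forall X, X = H (P X) + L (Q X) }.

Hypothesis S : splitting.
Variables (J : V -> V) (g : V -> V -> F).
Hypothesis J_lin : linear J.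
Hypothesis J_sqr : forall x, J (J x) = - x.
Hypothesis g_lin : forall a x y z, g (a *: x + y) z = a * g x z + g y z.
Hypothesis g_sym : forall x y, g x y = g y x.

Definition split_acs (X : W) : W := H (J (P X)) + L (J (Q X)).

Let J0 : J 0 = 0.
Proof. by have := J_lin (-1) 0 0; rewrite scaler0 addr0 scaleN1r addNr. Qed.
Let H0 : H 0 = 0.
Proof. by have := spl_H S (-1) 0 0; rewrite scaler0 addr0 scaleN1r addNr. Qed.
Let L0 : L 0 = 0.
Proof. by have := spl_L S (-1) 0 0; rewrite scaler0 addr0 scaleN1r addNr. Qed.
Let P_HL x y : P (H x + L y) = x.
Proof.
have := spl_P S 1 (H x) (L y).
by rewrite !scale1r (spl_PH S) (spl_PL S) addr0.
Qed.
Let Q_HL x y : Q (H x + L y) = y.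
Proof.
have := spl_Q S 1 (H x) (L y).
by rewrite !scale1r (spl_QL S) (spl_QH S) add0r.
Qed.

Lemma split_acs_linear : linear split_acs.
Proof.
move=> a X Y; rewrite /split_acs (spl_P S) (spl_Q S) !J_lin (spl_H S) (spl_L S).
by rewrite scalerDr addrACA.
Qed.

Lemma split_acsH x : split_acs (H x) = H (J x).
Proof. by rewrite /split_acs (spl_PH S) (spl_QH S) J0 L0 addr0. Qed.

Lemma split_acsL y : split_acs (L y) = L (J y).
Proof. by rewrite /split_acs (spl_QL S) (spl_PL S) J0 H0 add0r. Qed.

Lemma split_acs_sqr X : split_acs (split_acs X) = - X.
Proof.
rewrite /split_acs P_HL Q_HL !J_sqr [in RHS](spl_sum S X) opprD.
have HN x : H (- x) = - H x.
  by have := spl_H S (-1) x 0; rewrite !scaleN1r H0 !addr0.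
have LN x : L (- x) = - L x.
  by have := spl_L S (-1) x 0; rewrite !scaleN1r L0 !addr0.
by rewrite HN LN.
Qed.

Lemma split_acs_unique (K : W -> W) : linear K ->
  (forall x, K (H x) = H (J x)) -> (forall y, K (L y) = L (J y)) ->
  K =1 split_acs.
Proof.
move=> K_lin KH KL X; rewrite {1}(spl_sum S X) -[H _]scale1r K_lin.
by rewrite scale1r KH KL.
Qed.

Variables f b c h : F.

Definition split_form (X Y : W) : F :=
  f * g (P X) (P Y) + h * g (Q X) (Q Y)
  + g (b *: P X + c *: J (P X)) (Q Y) + g (b *: P Y + c *: J (P Y)) (Q X).

Let g0l z : g 0 z = 0.
Proof. by have := g_lin (-1) 0 0 z; rewrite scaler0 addr0 mulN1r addNr. Qed.
Let g0r z : g z 0 = 0. Proof. by rewrite g_sym. Qed.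
Let gD x y z : g (x + y) z = g x z + g y z.
Proof. by have := g_lin 1 x y z; rewrite scale1r mul1r. Qed.
Let gZ a x z : g (a *: x) z = a * g x z.
Proof. by have := g_lin a x 0 z; rewrite g0l !addr0. Qed.
Let gN x z : g (- x) z = - g x z.
Proof. by rewrite -scaleN1r gZ mulN1r. Qed.

Lemma split_form_sym X Y : split_form X Y = split_form Y X.
Proof.
by rewrite /split_form (g_sym (P X)) (g_sym (Q X) (Q Y)) addrAC.
Qed.

Lemma split_form_linear a X Y Z :
  split_form (a *: X + Y) Z = a * split_form X Z + split_form Y Z.
Proof.
rewrite /split_form (spl_P S) (spl_Q S) J_lin !gD !gZ !gD !gZ.
rewrite (g_sym _ (a *: Q X + Q Y)) (g_sym (J (P Z)) (a *: Q X + Q Y)) !gD !gZ.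
rewrite (g_sym _ (Q X)) (g_sym _ (Q Y)) (g_sym _ (Q X)) (g_sym _ (Q Y)).
ring.
Qed.

Lemma split_formHH x y : split_form (H x) (H y) = f * g x y.
Proof. by rewrite /split_form !(spl_PH S) !(spl_QH S) !g0r mulr0 !addr0. Qed.

Lemma split_formLL x y : split_form (L x) (L y) = h * g x y.
Proof.
rewrite /split_form !(spl_PL S) !(spl_QL S) J0 !scaler0 !addr0 !g0l.
by rewrite mulr0 add0r !addr0.
Qed.

Lemma split_formHL x y : split_form (H x) (L y) = g (b *: x + c *: J x) y.
Proof.
rewrite /split_form (spl_PL S) (spl_QL S) (spl_PH S) (spl_QH S) !g0r g0l.
by rewrite !mulr0 !add0r addr0.
Qed.

Lemma split_form_unique (B : W -> W -> F) :
  (forall a X Y Z, B (a *: X + Y) Z = a * B X Z + B Y Z) ->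
  (forall X Y, B X Y = B Y X) ->
  (forall x y, B (H x) (H y) = f * g x y) ->
  (forall x y, B (L x) (L y) = h * g x y) ->
  (forall x y, B (H x) (L y) = g (b *: x + c *: J x) y) ->
  forall X Y, B X Y = split_form X Y.
Proof.
move=> B_lin B_sym BHH BLL BHL X Y.
have BD U U' Z : B (U + U') Z = B U Z + B U' Z.
  by have := B_lin 1 U U' Z; rewrite scale1r mul1r.
rewrite {1}(spl_sum S X) {1}(spl_sum S Y) BD !(B_sym _ (_ + _)) !BD.
rewrite BHH BLL (B_sym (L _) (H _)) !BHL /split_form.
by rewrite (g_sym (P Y)) (g_sym (Q Y)); ring.
Qed.

Hypothesis g_J : forall x y, g (J x) (J y) = g x y.

Lemma split_form_compatible X Y :
  split_form (split_acs X) (split_acs Y) = split_form X Y.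
Proof.
by rewrite /split_form /split_acs !P_HL !Q_HL !gD !gZ !g_J.
Qed.

Hypothesis g_nondeg : forall x, (forall y, g x y = 0) -> x = 0.
Hypothesis det_neq0 : f * h - (b ^+ 2 + c ^+ 2) != 0.

(** Pairing a kernel vector [x^h + y^v] with [z^h] and [z^v] gives the linear
equations [E1] and [E2] for all [z].  Eliminating [y] or [x] multiplies the
remaining vector by the determinant. *)
Lemma split_form_nondeg X : (forall Y, split_form X Y = 0) -> X = 0.
Proof.
move=> X0; set x := P X; set y := Q X.
have g_skew w z : g (J w) z = - g w (J z).
  by rewrite -(g_J w (J z)) J_sqr (g_sym _ (- z)) gN opprK g_sym.
have E1 z : f * g x z + b * g y z + c * g y (J z) = 0.
  have := X0 (H z); rewrite /split_form (spl_PH S) (spl_QH S) !g0r mulr0 !addr0.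
  by rewrite gD !gZ (g_sym z) (g_sym (J z)) addrA.
have E2 z : h * g y z + b * g x z - c * g x (J z) = 0.
  have := X0 (L z); rewrite /split_form (spl_PL S) (spl_QL S) J0 !scaler0 addr0.
  by rewrite g0l g0r mulr0 add0r addr0 gD !gZ g_skew mulrN addrA.
have gJJ w z : g w (J (J z)) = - g w z.
  by rewrite J_sqr (g_sym _ (- z)) gN g_sym.
have x0 : x = 0.
  apply: g_nondeg => z; apply: (mulfI det_neq0); rewrite mulr0.
  (* The first equation times [h], minus the second one times [b - c J]. *)
  transitivity (h * (f * g x z + b * g y z + c * g y (J z))
     - b * (h * g y z + b * g x z - c * g x (J z))
     - c * (h * g y (J z) + b * g x (J z) - c * g x (J (J z)))).
    by rewrite gJJ; ring.
  by rewrite E1 !E2 !mulr0 !subr0.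
have y0 : y = 0.
  apply: g_nondeg => z; apply: (mulfI det_neq0); rewrite mulr0.
  (* The second equation times [f], minus the first one times [b + c J]. *)
  transitivity (f * (h * g y z + b * g x z - c * g x (J z))
     - b * (f * g x z + b * g y z + c * g y (J z))
     + c * (f * g x (J z) + b * g y (J z) + c * g y (J (J z)))).
    by rewrite gJJ; ring.
  by rewrite !E1 E2 !mulr0 subr0 addr0.
by rewrite (spl_sum S X) -/x -/y x0 y0 H0 L0 addr0.
Qed.

End SplittingAlgebra.

(** * The lifted structure and the ciconia metric in charts *)

Section Linearity.
Context {K : pzRingType} {U V : lmodType K}.
Lemma linear_sumE (f : U -> V) m (a : 'I_m -> K) (v : 'I_m -> U) : linear f ->
  f (\sum_(l < m) a l *: v l) = \sum_(l < m) a l *: f (v l).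
Proof.
move=> fL; elim: m a v => [|m IH] a v.
  rewrite !big_ord0; have := fL (-1) 0 0.
  by rewrite scaler0 addr0 scaleN1r addNr.
by rewrite !big_ord_recl fL IH.
Qed.
End Linearity.

Section Splitting.
Context {R : realType} {n : nat} {M : atlas R n}.
Hypothesis cM : compatible_charts M.
Local Notation TM := (tangent_bundle M).
Let cT : compatible_charts TM := tangent_bundle_compatible cM.
Context {D : covariant_derivative M}.
Hypothesis cD : is_connection D.
Hypothesis covM : forall p : M, exists i : index M, dom i p.
Implicit Types (i : index M) (u : TM).

(** The differential of the bundle projection, read in the chart. *)
Definition hpart i u (X : tangent u) : tangent (tag u) :=
  chart_vec i (tag u) (lsubmx (X i)).
(** The connector of the connection, read in the chart: the horizontal lift of
[hpart i X] has vertical coordinates [- christoffel i (hpart i X) u], whose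
removal leaves the vertical component of [X]. *)
Definition vpart i u (X : tangent u) : tangent (tag u) :=
  chart_vec i (tag u)
    (rsubmx (X i) + christoffel (D := D) i (hpart i X) (tagged u i)).

Lemma hpart_chart i u (X : tangent u) :
  dom i (tag u) -> hpart i X i = lsubmx (X i).
Proof. exact: chart_vecE. Qed.
Lemma vpart_chart i u (X : tangent u) : dom i (tag u) ->
  vpart i X i = rsubmx (X i) + christoffel (D := D) i (hpart i X) (tagged u i).
Proof. exact: chart_vecE. Qed.

Lemma hv_splitting i u : dom i (tag u) ->
  splitting (@hlift _ _ M D u) (@vlift _ _ M u) (@hpart i u) (@vpart i u).
Proof.
move=> iu; have ext := fun X Y : tangent u => @tangent_ext _ _ TM u X Y i iu.
have tPD (X Y : tangent u) a : (a *: X + Y) i = a *: X i + Y i by [].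
have tD (X Y : tangent u) : (X + Y) i = X i + Y i by [].
have := fun x => hlift_chart cM cD covM x iu.
have := fun x => vlift_chart cM covM x iu.
(* From here on the lifts are known only by their coordinate formulas. *)
move: (@hlift _ _ M D u) (@vlift _ _ M u) => hl vl vE hE.
have P_lin : linear (@hpart i u).
  move=> a X Y; apply: (tangent_ext iu).
  by rewrite tangentD tangentZ !hpart_chart // tPD linearP.
have PH : cancel hl (@hpart i u).
  by move=> x; apply: (tangent_ext iu); rewrite hpart_chart // hE row_mxKl.
have PL x : hpart i (vl x) = 0.
  by apply: (tangent_ext iu); rewrite hpart_chart // vE row_mxKl.
split=> //.
- move=> a x y; apply: ext; rewrite tPD !hE.
  rewrite (christoffelP cM cD) // tangentD tangentZ.
  by rewrite scale_row_mx add_row_mx scalerN opprD.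
- move=> a x y; apply: ext; rewrite tPD !vE tangentD tangentZ.

  by rewrite scale_row_mx add_row_mx scaler0 addr0.
- move=> a X Y; apply: (tangent_ext iu).
  rewrite tangentD tangentZ !vpart_chart // P_lin (christoffelP cM cD) //.
  by rewrite tPD linearP scalerDr addrACA.
- move=> x; apply: (tangent_ext iu).
  by rewrite vpart_chart // PH hE row_mxKr addNr.
- move=> x; apply: (tangent_ext iu).
  by rewrite vpart_chart // PL (christoffel0 cM cD) // vE row_mxKr addr0.
- move=> X; apply: ext; rewrite tD hE vE add_row_mx addr0.
  by rewrite vpart_chart // hpart_chart // addrCA addNr addr0 hsubmxK.
Qed.


Context {J : endo_field M} {g : bilinear_field M}.
Hypothesis acJ : almost_complex J.
Hypothesis ahg : almost_hermitian g J.

(** A linear map is determined by its values on horizontal and vertical lifts,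
so the structure chosen in the definition is the one given by the splitting. *)
Lemma lifted_acsE i u (X : tangent u) : dom i (tag u) ->
  lifted_acs D J X = split_acs (@hlift _ _ M D u) (@vlift _ _ M u)
    (@hpart i u) (@vpart i u) (J (p := tag u)) X.
Proof.
move=> iu; have S := hv_splitting iu; have JL := acs_linear acJ (p := tag u).
rewrite /lifted_acs; case: xgetP => [K _ [KL KH KV]|].
  exact: (split_acs_unique S KL KH KV).
move=> /(_ (split_acs (@hlift _ _ M D u) (@vlift _ _ M u)
    (@hpart i u) (@vpart i u) (J (p := tag u)))); case; split.
- exact: (split_acs_linear S JL).
- exact: (split_acsH S JL).
- exact: (split_acsL S JL).
Qed.


Let gS := metric_sym (ah_metric ahg).

(** Likewise a symmetric bilinear form is determined by its values on pairs of
lifts. *)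
Lemma ciconiaE (f b c h : TM -> R) i u (X Y : tangent u) : dom i (tag u) ->
  ciconia g J D f b c h X Y =
  split_form (@hpart i u) (@vpart i u) (J (p := tag u)) (g (p := tag u))
    (f u) (b u) (c u) (h u) X Y.
Proof.
move=> iu; have S := hv_splitting iu; have JL := acs_linear acJ (p := tag u).
have [gL gC] := gS (tag u).
rewrite /ciconia; case: xgetP => [G _ [[GL GC] GH GV GHV]|].
  exact: (split_form_unique S gC GL GC GH GV GHV).
move=> /(_ (split_form (@hpart i u) (@vpart i u) (J (p := tag u))
    (g (p := tag u)) (f u) (b u) (c u) (h u))); case; split.
- split; first exact: (split_form_linear S JL gL gC).
  exact: (split_form_sym _ _ _ gC).
- exact: (split_formHH S _ gL gC).
- exact: (split_formLL S JL gL).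
- exact: (split_formHL S _ gL gC).
Qed.


Section Along.
Variables (i : index M) (u : TM).
Hypothesis iu : dom i (tag u).
Local Notation smooth_along xi :=
  (smooth_in (M := TM) i (fun u' : TM => xi u' i) u).
Implicit Types xi eta : forall u' : TM, tangent (tag u').
Let nT := chart_nbhsT cT iu.
Let sE (w : 'rV[R]_n) : smooth_vfield_at (fun q => chart_vec i q w) (tag u) :=
  smooth_chart_vec cM w iu.

Lemma smooth_along_coord xi l : smooth_along xi ->
  smooth_in (M := TM) i (fun u' => row_coord l (xi u' i)) u.
Proof. by move=> sx; exact: (smooth_in_lin cT (row_coord l) iu sx). Qed.

(** For vector fields along the bundle projection, which are not vector fields
on [M], the smoothness of [J] is available only through its values on the
coordinate frame.  The same holds for the connection and for the metric. *)
Lemma smooth_along_acs xi :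
  smooth_along xi -> smooth_along (fun u' => J (xi u')).
Proof.
move=> sx.
have S : smooth_in (M := TM) i (fun u' => \sum_(l < n) row_coord l (xi u' i) *:
    J (chart_vec i (tag u') (delta_mx 0 l)) i) u.
  apply: (smooth_in_sum cT iu) => l.
  apply: (smooth_inZ cT iu (smooth_along_coord l sx)).
  exact: (smooth_in_proj cM iu (acs_smooth acJ (sE _) iu)).
apply: (smooth_in_eq cT nT) S => u' iu' _.
rewrite [in RHS](tangent_expand cM (xi u') iu').
by rewrite (linear_sumE _ _ (acs_linear acJ (p := tag u'))) tangent_sum.
Qed.

Lemma smooth_along_christoffel xi : smooth_along xi ->
  smooth_in (M := TM) i
    (fun u' => christoffel (D := D) i (xi u') (tagged u' i)) u.
Proof.
move=> sx.
have S : smooth_in (M := TM) i (fun u' =>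
    \sum_(l < n) row_coord l (tagged u' i) *:
    \sum_(k < n) row_coord k (xi u' i) *:
      D (chart_vec i (tag u') (delta_mx 0 k))
        (fun q => chart_vec i q (delta_mx 0 l)) i) u.
  apply: (smooth_in_sum cT iu) => l.
  apply: (smooth_inZ cT iu (smooth_along_coord l (smooth_in_fiber cM iu))).
  apply: (smooth_in_sum cT iu) => k.
  apply: (smooth_inZ cT iu (smooth_along_coord k sx)).
  exact: (smooth_in_proj cM iu (conn_smooth cD
    (sE (delta_mx 0 k)) (sE (delta_mx 0 l)) iu)).
apply: (smooth_in_eq cT nT) S => u' iu' _.
rewrite /christoffel; apply: eq_bigr => l _; congr (_ *: _).
rewrite [in RHS](tangent_expand cM (xi u') iu').
have DL := conn_linear cD (smooth_chart_vec cM (delta_mx 0 l) iu').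
by rewrite (linear_sumE _ _ DL) tangent_sum.
Qed.

Lemma smooth_along_metric xi eta : smooth_along xi -> smooth_along eta ->
  smooth_in (M := TM) i (fun u' => g (xi u') (eta u')) u.
Proof.
move=> sx sy.
have S : smooth_in (M := TM) i (fun u' => \sum_(k < n) row_coord k (xi u' i) *:
    \sum_(l < n) row_coord l (eta u' i) *:
      g (chart_vec i (tag u') (delta_mx 0 l))
        (chart_vec i (tag u') (delta_mx 0 k))) u.
  apply: (smooth_in_sum cT iu) => k.
  apply: (smooth_inZ cT iu (smooth_along_coord k sx)).
  apply: (smooth_in_sum cT iu) => l.
  apply: (smooth_inZ cT iu (smooth_along_coord l sy)).
  exact: (smooth_in_proj cM iu (metric_smooth (ah_metric ahg)
    (sE (delta_mx 0 l)) (sE (delta_mx 0 k)) iu)).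
apply: (smooth_in_eq cT nT) S => u' iu' _.
have [gL gC] := gS (tag u').
have gl z : linear (fun x : tangent (tag u') => g x z : R^o).
  by move=> a x y; exact: gL.
rewrite [in RHS](tangent_expand cM (xi u') iu') (linear_sumE _ _ (gl _)).
apply: eq_bigr => k _; congr (_ *: _).
rewrite [RHS]gC [in RHS](tangent_expand cM (eta u') iu').
by rewrite (linear_sumE _ _ (gl _)).
Qed.

Lemma smooth_alongD xi eta : smooth_along xi -> smooth_along eta ->
  smooth_along (fun u' => xi u' + eta u').
Proof. exact: smooth_inD. Qed.

Lemma smooth_alongZ (F : TM -> R) xi : smooth_in (M := TM) i F u ->
  smooth_along xi -> smooth_along (fun u' => F u' *: xi u').
Proof. exact: smooth_inZ. Qed.

Variable X : vfield TM.
Hypothesis sX : smooth_vfield_at X u.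

Lemma smooth_along_hpart : smooth_along (fun u' => hpart i (X u')).
Proof.
have S := smooth_in_lin cT lsubmx iu (sX iu).
by apply: (smooth_in_eq cT nT) S => u' iu' _; rewrite hpart_chart.
Qed.

Lemma smooth_along_vpart : smooth_along (fun u' => vpart i (X u')).
Proof.
have S := smooth_inD cT iu (smooth_in_lin cT rsubmx iu (sX iu))
  (smooth_along_christoffel smooth_along_hpart).
by apply: (smooth_in_eq cT nT) S => u' iu' _; rewrite vpart_chart.
Qed.

End Along.

Lemma lifted_acs_smooth u (X : vfield TM) : smooth_vfield_at X u ->
  smooth_vfield_at (fun u' => lifted_acs D J (X u')) u.
Proof.
move=> sX i iu; have iu' : @dom _ _ M i (tag u) := iu.
have sh := smooth_along_acs iu' (smooth_along_hpart iu' sX).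
have sv := smooth_along_acs iu' (smooth_along_vpart iu' sX).
have sc := smooth_along_christoffel iu' sh.
have sN := smooth_inZ cT iu (smooth_in_cst cT (-1 : R) iu) sc.
have sB := smooth_inD cT iu sN sv.
have S := smooth_in_row cT iu sh sB.
apply: (smooth_in_eq cT (chart_nbhsT cT iu)) S => w iw _.
rewrite (lifted_acsE _ iw).
transitivity
  (hlift D (J (hpart i (X w))) i + vlift (J (vpart i (X w))) i) => //.
rewrite (hlift_chart cM cD covM _ iw) (vlift_chart cM covM _ iw).
by rewrite add_row_mx addr0 scaleN1r.
Qed.

Lemma ciconia_smooth (f b c h : TM -> R) u (X Y : vfield TM) :
  smooth_fun_at f u -> smooth_fun_at b u -> smooth_fun_at c u ->
  smooth_fun_at h u -> smooth_vfield_at X u -> smooth_vfield_at Y u ->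
  smooth_fun_at (fun u' => ciconia g J D f b c h (X u') (Y u')) u.
Proof.
move=> sf sb sc sh sX sY i iu; have iu' : @dom _ _ M i (tag u) := iu.
have cross Z Z' (sZ : smooth_vfield_at Z u) (sZ' : smooth_vfield_at Z' u) :
    smooth_in (M := TM) i (fun w =>
      g (b w *: hpart i (Z w) + c w *: J (hpart i (Z w))) (vpart i (Z' w))) u.
  have sP := smooth_along_hpart iu' sZ.
  apply: (smooth_along_metric iu' _ (smooth_along_vpart iu' sZ')).
  apply: (smooth_alongD iu' (smooth_alongZ iu' (sb i iu) sP)).
  exact: (smooth_alongZ iu' (sc i iu) (smooth_along_acs iu' sP)).
have sPP := smooth_along_metric iu'
  (smooth_along_hpart iu' sX) (smooth_along_hpart iu' sY).
have sQQ := smooth_along_metric iu'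
  (smooth_along_vpart iu' sX) (smooth_along_vpart iu' sY).
have S := smooth_inD cT iu (smooth_inD cT iu (smooth_inD cT iu
  (smooth_inZ cT iu (sf i iu) sPP) (smooth_inZ cT iu (sh i iu) sQQ))
  (cross X Y sX sY)) (cross Y X sY sX).
apply: (smooth_in_eq cT (chart_nbhsT cT iu)) S => w iw _.
by rewrite (ciconiaE _ _ _ _ _ _ iw).
Qed.

End Splitting.

Theorem theorem1p1 (R : realType) (n : nat) (M : atlas R n)
    (g : bilinear_field M) (J : endo_field M) (nabla : covariant_derivative M)
    (f h b c : tangent_bundle M -> R) :
  smooth_manifold M ->
  positive_definite g ->
  almost_hermitian g J ->
  levi_civita g nabla ->
  (forall u, smooth_fun_at f u) -> (forall u, smooth_fun_at h u) ->
  (forall u, smooth_fun_at b u) -> (forall u, smooth_fun_at c u) ->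
  (forall u, f u * h u - (b u ^+ 2 + c u ^+ 2) != 0) ->
  almost_hermitian (ciconia g J nabla f b c h) (lifted_acs nabla J).
Proof.
move=> sM _ ahg lc sf sh sb sc det.
have cM := manifold_compatible sM.
have cD := lc_connection lc.
have covM := atlas_cover sM.
have acJ := ah_complex ahg.
have JL (u : tangent_bundle M) := acs_linear acJ (p := tag u).
have gL (u : tangent_bundle M) := (metric_sym (ah_metric ahg) (tag u)).1.
have gC (u : tangent_bundle M) := (metric_sym (ah_metric ahg) (tag u)).2.
have gE := ciconiaE cM cD covM acJ ahg f b c h.
have KE := lifted_acsE cM cD covM acJ.
have split_at (u : tangent_bundle M) : exists2 i : index M, dom i (tag u) &
    splitting (@hlift _ _ M nabla u) (@vlift _ _ M u)
      (@hpart _ _ M i u) (@vpart _ _ M nabla i u).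
  by have [i iu] := covM (tag u); exists i => //; exact: hv_splitting.
split; first split.
- move=> u; have [i iu S] := split_at u; split=> [a X Y Z|X Y].
    by rewrite !(gE _ _ _ _ iu) (split_form_linear S (JL u) (gL u) (gC u)).
  by rewrite !(gE _ _ _ _ iu) (split_form_sym _ _ _ (gC u)).
- move=> u X X0; have [i iu S] := split_at u.
  have H := split_form_nondeg S (JL u) (acs_sqr acJ (p := tag u)) (gL u) (gC u)
    (ah_compatible ahg (p := tag u))
    (metric_nondeg (ah_metric ahg) (p := tag u)) (det u).
  apply: H => Y.
  by rewrite -(gE _ _ _ _ iu).
- move=> u X Y sX sY; exact: ciconia_smooth.
- split=> [u|u X|u X sX].
  + have [i iu S] := split_at u => a X Y.
    by rewrite !(KE _ _ _ iu) (split_acs_linear S (JL u)).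
  + have [i iu S] := split_at u; rewrite !(KE _ _ _ iu).
    exact: (split_acs_sqr S (acs_sqr acJ (p := tag u))).
  + exact: lifted_acs_smooth.
- move=> u X Y; have [i iu S] := split_at u.
  rewrite !(KE _ _ _ iu) !(gE _ _ _ _ iu).
  exact: (split_form_compatible S (gL u) _ _ _ _
    (ah_compatible ahg (p := tag u))).
Qed.
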